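(* In the setting below, let $\theta\in\mathcal O_{K_1}$ be admissible and $\mathfrak R_\theta:=k(\sqrt[3]{\pi_1},\sqrt[3]{\pi_2},\sqrt[3]{\theta})$. Then: (1) $\mathfrak R_\theta=k(\sqrt[3]{\theta^{(1)}},\sqrt[3]{\theta^{(2)}},\sqrt[3]{\theta^{(3)}})$, where $\theta^{(1)}=\theta$, $\theta^{(2)}=\tau(\theta)$, $\theta^{(3)}=\tau^2(\theta)$; (2) $\mathfrak R_\theta/k$ is a Galois extension which is unramified outside $\mathfrak p_1$ and $\mathfrak p_2$, and the ramification index of each $\mathfrak p_i$ ($i=1,2$) is $3$; (3) $\mathrm{Gal}(\mathfrak R_\theta/k)$ is isomorphic to $N_3(\mathbb F_3)$.
   Context: $k=\mathbb Q(\zeta_3)$, $\zeta_3=\frac{-1+\sqrt{-3}}{2}$, $\mathcal O_k=\mathbb Z[\zeta_3]$. Let $\mathfrak p_1,\mathfrak p_2$ be distinct finite primes of $k$ not above $3$ with $\mathrm N\mathfrak p_i\equiv1\bmod9$, and $\pi_i\in\mathcal O_k$ the unique generators of $\mathfrak p_i$ with $\pi_i\equiv1\bmod(3\sqrt{-3})$. Assume $\pi_1$ is a cube in $k_{\mathfrak p_2}^\times$ and $\pi_2$ is a cube in $k_{\mathfrak p_1}^\times$. Let $K_1=k(\sqrt[3]{\pi_1})$ and $\tau\in\mathrm{Gal}(K_1/k)$ with $\tau(\sqrt[3]{\pi_1})=\zeta_3\sqrt[3]{\pi_1}$. Fix a prime $\mathfrak P$ of $K_1$ over $\mathfrak p_2$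 and set $\mathfrak P^{(1)}=\mathfrak P$, $\mathfrak P^{(2)}=\tau(\mathfrak P)$, $\mathfrak P^{(3)}=\tau^2(\mathfrak P)$ (the three primes of $K_1$ above $\mathfrak p_2$). Call $\theta\in\mathcal O_{K_1}$ admissible if $\theta=\zeta_3^c\,\alpha^2\tau(\alpha)$ for some $c\in\{0,1,2\}$ and some $\alpha\in\mathcal O_{K_1}$ with $\mathrm N_{K_1/k}(\alpha)=\pi_2\beta^3$ for some $\beta\in k$ and $(\alpha)=\mathfrak P^a\mathfrak B^b$ with $3\nmid a$, $\mathfrak B$ an ideal coprime to $3$, $3\mid b$; and moreover there exists $\eta\in\mathcal O_{K_1}$ with $\eta^3\equiv\theta\bmod (3\sqrt{-3})\mathcal O_{K_1}$. $N_3(\mathbb F_3)$ is the group of $3\times3$ upper triangular unipotent matrices over $\mathbb F_3$. *)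

(* Defs.v *)
From HB Require Import structures.
From mathcomp Require Import all_boot all_order all_algebra all_field.
Set Implicit Arguments. Unset Strict Implicit. Unset Printing Implicit Defensive.
Import Order.TTheory GRing.Theory Num.Theory.
Local Open Scope ring_scope.

Definition sqrtm3 : algC := 'i * sqrtC 3.
Definition zeta3 : algC := (-1 + sqrtm3) / 2.

Definition is_subfield (F : algC -> Prop) : Prop :=
  [/\ F 0, F 1, (forall x y, F x -> F y -> F (x - y)),
      (forall x y, F x -> F y -> F (x * y)) & (forall x, F x -> F x^-1)].

Definition genfield (S : seq algC) (x : algC) : Prop :=
  forall F : algC -> Prop, is_subfield F -> (forall s, s \in S -> F s) -> F x.

Definition kk : algC -> Prop := genfield [:: zeta3].

Definition ints (F : algC -> Prop) (x : algC) : Prop := F x /\ x \in Aint.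

Definition Ok : algC -> Prop := ints kk.

Definition is_ideal (O I : algC -> Prop) : Prop :=
  [/\ (forall x, I x -> O x), I 0, (forall x y, I x -> I y -> I (x + y))
    & (forall r x, O r -> I x -> I (r * x))].

Definition ideal_gen (O S : algC -> Prop) (x : algC) : Prop :=
  forall I, is_ideal O I -> (forall s, S s -> I s) -> I x.

Definition pideal (O : algC -> Prop) (a : algC) : algC -> Prop :=
  ideal_gen O (fun z => z = a).

Definition ideal_mul (O I J : algC -> Prop) : algC -> Prop :=
  ideal_gen O (fun z => exists x y, [/\ I x, J y & z = x * y]).

Fixpoint ideal_exp (O I : algC -> Prop) (n : nat) : algC -> Prop :=
  match n with
  | 0 => O
  | n'.+1 => ideal_mul O (ideal_exp O I n') I
  end.

Definition ideal_eq (I J : algC -> Prop) : Prop := forall x, I x <-> J x.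

Definition is_prime_ideal (O P : algC -> Prop) : Prop :=
  [/\ is_ideal O P, ~ P 1 &
      (forall x y, O x -> O y -> P (x * y) -> P x \/ P y)].

Definition is_nz_prime_ideal (O P : algC -> Prop) : Prop :=
  is_prime_ideal O P /\ exists x, P x /\ x != 0.

Definition ideal_coprime (O I J : algC -> Prop) : Prop :=
  ideal_gen O (fun z => I z \/ J z) 1.

Definition congr_in (O : algC -> Prop) (a b m : algC) : Prop :=
  exists g, O g /\ a - b = m * g.

(* ramification index: e(Q | p) = e  iff  p O in Q^e but not in Q^(e+1),
   i.e. e = v_Q(p O_F), for a nonzero prime Q of O and p a generator of
   the prime of the base below Q *)
Definition ram_index (O Q : algC -> Prop) (p : algC) (e : nat) : Prop :=
  ideal_exp O Q e p /\ ~ ideal_exp O Q e.+1 p.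

(* a (an element of O_k prime to pi) is a cube in the completion k_(pi)^x:
   a is a cube modulo every power of pi (equivalent to being a cube in
   the complete local ring since a is a local unit) *)
Definition local_cube (a pi : algC) : Prop :=
  forall n : nat, exists x, Ok x /\ congr_in Ok (x ^+ 3) a (pi ^+ n).

(* a subfield F (finite over k) is Galois over k: normal, i.e. stable under
   every k-automorphism of the ambient algC (separability is automatic in
   characteristic 0) -- this is MathComp's normalField/galois notion *)
Definition galois_over (K F : algC -> Prop) : Prop :=
  forall s : {rmorphism algC -> algC},
    (forall x, K x -> s x = x) -> forall x, F x -> F (s x).

Definition unitri (M : 'M['F_3]_3) : bool :=
  [forall i : 'I_3, forall j : 'I_3,
     ((j < i)%N ==> (M i j == 0)) && ((i == j) ==> (M i j == 1))].

(* Gal(F/K) (realised as restrictions to F of K-automorphisms of algC)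
   is isomorphic to N_3(F_3) *)
Definition gal_iso_N3 (K F : algC -> Prop) : Prop :=
  exists f : 'M['F_3]_3 -> {rmorphism algC -> algC},
    [/\ (forall M, unitri M -> forall x, K x -> f M x = x),
        (forall M N, unitri M -> unitri N ->
           forall x, F x -> f (M *m N) x = f M (f N x)),
        (forall M N, unitri M -> unitri N -> M != N ->
           exists x, F x /\ f M x != f N x)
      & (forall s : {rmorphism algC -> algC}, (forall x, K x -> s x = x) ->
           exists M, unitri M /\ forall x, F x -> s x = f M x)].

Definition normalized_prime (pi : algC) : Prop :=
  [/\ Ok pi, is_prime_ideal Ok (pideal Ok pi),
      ~ pideal Ok sqrtm3 pi,                                   (* not above 3 *)
      (exists n : nat, pi * pi^* = n%:R /\ (n %% 9 = 1)%N)     (* N p = 1 mod 9 *)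
    & congr_in Ok pi 1 (3 * sqrtm3)].

(* admissibility of theta in O_{K1}, with K1 = k(a1), tau the generator,
   P a fixed prime of K1 above p2 *)
Definition admissible (OK1 : algC -> Prop) (tau : algC -> algC)
    (pi2 : algC) (P : algC -> Prop) (theta : algC) : Prop :=
  OK1 theta /\
  exists (c : 'I_3) (alpha beta : algC),
    [/\ theta = zeta3 ^+ c * alpha ^+ 2 * tau alpha,
        OK1 alpha /\ kk beta,
        alpha * tau alpha * tau (tau alpha) = pi2 * beta ^+ 3,
        (exists (a b : nat) (B : algC -> Prop),
           [/\ is_ideal OK1 B, ideal_coprime OK1 B (pideal OK1 3),
               ~~ (3 %| a)%N, (3 %| b)%N &
               ideal_eq (pideal OK1 alpha)
                 (ideal_mul OK1 (ideal_exp OK1 P a) (ideal_exp OK1 B b))])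
      & exists eta, OK1 eta /\ congr_in OK1 (eta ^+ 3) theta (3 * sqrtm3)].

(* Main.v *)
Require Import Defs.
From HB Require Import structures.
From mathcomp Require Import all_boot all_order all_algebra all_field.
From mathcomp Require Import ring zify.
From Stdlib Require Import Classical.
Import Order.TTheory GRing.Theory Num.Theory.
Local Open Scope ring_scope.

(* Write u = a2 beta / alpha, so that u^3 = tau theta / theta.  Since pi2 is not a cube in
   K1 = k(a1), neither is u^3, whence a2 is not in K1 and t is not in K2 = k(a1, a2); this yields
   k-automorphisms x, y, z with x : (a1, a2, t) -> (zeta a1, a2, t u), y moving only a2 and z
   moving only t.  They satisfy the Heisenberg relations and exhaust the automorphisms of R over k.

   Ramification is computed along the cubic steps of k < K1 < K2 < R (or k < k(a2) < K2 < R),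
   without Dedekind theory.  In a step F' / F with generating automorphism s, if some integer y
   has y - s y and y - s^2 y outside the prime Q, then Q is generated locally by Q cap F.  Such
   a y is (b - eta) / (1 - zeta) for a radical b = a1, a2 or t congruent to a cube eta^3 modulo
   (1 - zeta)^3, as y - s y = b, provided b is outside Q.  If t lies in Q, then Q is not above 3,
   and one multiplies t by an element of K2 to make it a unit at Q: locally, theta is a unit
   times a cube times a power of pi2 = a2^3.  Above pi1 and pi2 the bottom step is totally
   ramified with a1, respectively a2, as uniformizer. *)

Set Implicit Arguments.
Unset Strict Implicit.
Unset Printing Implicit Defensive.

(** * Subfields of algC and their automorphisms *)

(** The form of theta explains u: in the group ring, (tau - 1)(tau + 2) = (1 + tau + tau^2) - 3, so
    theta = zeta^c alpha^2 tau(alpha) gives tau theta / theta = N(alpha) / alpha^3 = pi2 (beta /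
    alpha)^3. Hence tau preserves the class of theta modulo cubes of K2, which makes R normal over
    k, while u lies outside K1, which makes the group nonabelian. The modulus 3 sqrt(-3) equals -(1
    - zeta)^3, exactly what the integrality of (b - eta) / (1 - zeta) requires.

    Valuations and unique factorization of ideals are replaced by one inclusion: d Q is contained in
    u O for some d outside Q. It survives products, passes up a cubic step through traces, and
    implies that u^e is not in Q^(e+1), the only upper bound on ramification that is used. The order
    of adjunction depends on Q because a ramified step is put at the bottom, where the prime (pi_i)
    of O_k is principal and integers can be handled by their coordinates in 1, b, b^2. *)

Definition is_subring (O : algC -> Prop) : Prop :=
  [/\ O 1, (forall x y, O x -> O y -> O (x - y))
    & (forall x y, O x -> O y -> O (x * y))].

Section Subring.
Variables (O : algC -> Prop) (HO : is_subring O).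

Lemma subring1 : O 1. Proof. by case: HO. Qed.
Lemma subringB x y : O x -> O y -> O (x - y).
Proof. by case: HO => _ h _; apply: h. Qed.
Lemma subringM x y : O x -> O y -> O (x * y).
Proof. by case: HO => _ _; apply. Qed.
Lemma subring0 : O 0.
Proof. by rewrite -(subrr 1); apply: subringB; apply: subring1. Qed.
Lemma subringN x : O x -> O (- x).
Proof. by rewrite -sub0r; apply: subringB; apply: subring0. Qed.
Lemma subringD x y : O x -> O y -> O (x + y).
Proof. by rewrite -{2}[y]opprK => Ox Oy; apply: subringB => //; apply: subringN. Qed.
Lemma subring_nat n : O n%:R.
Proof.
elim: n => [|n IHn]; first exact: subring0.
by rewrite -natr1; apply: subringD => //; apply: subring1.
Qed.
Lemma subringX x n : O x -> O (x ^+ n).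
Proof.
move=> Ox; elim: n => [|n IHn]; first exact: subring1.
by rewrite exprS; apply: subringM.
Qed.
Lemma subring_int n : O n%:~R.
Proof.
by case: n => n; [|rewrite NegzE rmorphN; apply: subringN]; apply: subring_nat.
Qed.
End Subring.

Lemma subfield_subring F : is_subfield F -> is_subring F.
Proof. by case. Qed.

Lemma subfieldV F x : is_subfield F -> F x -> F x^-1.
Proof. by case=> _ _ _ _; apply. Qed.

Ltac mem_step HO :=
  match goal with
  | |- ?O 0 => exact: (subring0 HO)
  | |- ?O 1 => exact: (subring1 HO)
  | |- ?O (- _) => apply: (subringN HO)
  | |- ?O (_ + _) => apply: (subringD HO)
  | |- ?O (_ * _) => apply: (subringM HO)
  | |- ?O (_ ^+ _) => apply: (subringX HO)
  | |- ?O (_%:R) => exact: (subring_nat HO)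
  | |- ?O (_%:~R) => exact: (subring_int HO)
  end.
Ltac mem HO := repeat (first [assumption | mem_step HO]).

Lemma genfield_subfield S : is_subfield (genfield S).
Proof.
split=> [F [F0 _ _ _ _] _ | F [_ F1 _ _ _] _ | x y Sx Sy F HF FS
        | x y Sx Sy F HF FS | x Sx F HF FS] //.
- by case: (HF) => _ _ h _ _; apply: h; [apply: Sx | apply: Sy].
- by case: (HF) => _ _ _ h _; apply: h; [apply: Sx | apply: Sy].
- by case: (HF) => _ _ _ _; apply; apply: Sx.
Qed.

Lemma genfield_subring S : is_subring (genfield S).
Proof. exact: subfield_subring (genfield_subfield S). Qed.

Lemma genfield_mem S s : s \in S -> genfield S s.
Proof. by move=> Ss F _; apply. Qed.

Lemma genfield_min S F : is_subfield F -> (forall s, s \in S -> F s) ->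
  forall x, genfield S x -> F x.
Proof. by move=> HF FS x; apply. Qed.

Lemma genfield_sub S S' : {subset S <= S'} ->
  forall x, genfield S x -> genfield S' x.
Proof.
move=> sSS'; apply: genfield_min (genfield_subfield S') _ => s /sSS'.
exact: genfield_mem.
Qed.

Lemma eq_genfield S (f g : {rmorphism algC -> algC}) :
  {in S, f =1 g} -> forall x, genfield S x -> f x = g x.
Proof.
move=> fgS; apply: genfield_min => //; split; rewrite ?rmorph0 ?rmorph1 //.
- by move=> x y /= fgx fgy; rewrite !rmorphB fgx fgy.
- by move=> x y /= fgx fgy; rewrite !rmorphM fgx fgy.
- by move=> x /= fgx; rewrite !fmorphV fgx.
Qed.

Lemma fix_genfield S (f : {rmorphism algC -> algC}) :
  {in S, forall x, f x = x} -> forall x, genfield S x -> f x = x.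
Proof. exact: (@eq_genfield S f idfun). Qed.

Lemma rmorph_genfield S F (f : {rmorphism algC -> algC}) : is_subfield F ->
  (forall s, s \in S -> F (f s)) -> forall x, genfield S x -> F (f x).
Proof.
move=> HF; have HR := subfield_subring HF; apply: genfield_min.
split; rewrite ?rmorph0 ?rmorph1.
- exact: subring0.
- exact: subring1.
- by move=> x y /= Fx Fy; rewrite rmorphB; apply: subringB.
- by move=> x y /= Fx Fy; rewrite rmorphM; apply: subringM.
- by move=> x /= Fx; rewrite fmorphV; apply: subfieldV.
Qed.

Lemma ints_subring F : is_subfield F -> is_subring (ints F).
Proof.
move=> /subfield_subring HF; split; first by split; [apply: subring1 | exact: Aint1].
- by move=> x y [Fx Ax] [Fy Ay]; split; [apply: subringB | apply: rpredB].
- by move=> x y [Fx Ax] [Fy Ay]; split; [apply: subringM | apply: rpredM].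
Qed.

#[global] Opaque genfield.

(** * Automorphisms of algC from Galois theory of number fields *)

Lemma genfield_alg (L : fieldExtType rat) (f : {rmorphism L -> algC}) (s : seq L) x :
  x \in <<1 & s>>%VS -> genfield (map f s) (f x).
Proof.
elim/last_ind: s x => [|s b IHs] x.
  rewrite adjoin_nil subfield_closed => /vlineP[a ->].
  rewrite alg_num_field fmorph_rat /ratr.
  have HG := genfield_subring [::].
  apply: (subringM HG); first exact: (subring_int HG).
  exact: subfieldV (genfield_subfield _) (subring_int HG _).
rewrite adjoin_rcons => /Fadjoin_polyP[p /polyOverP Kp ->].
have HG := genfield_subring (map f (rcons s b)).
have sub y : genfield (map f s) y -> genfield (map f (rcons s b)) y.
  by apply: genfield_sub => z; rewrite map_rcons mem_rcons inE orbC => ->.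
rewrite horner_coef rmorph_sum /=.
elim/big_ind: _ => [||i _]; [exact: (subring0 HG) | by move=> *; apply: (subringD HG)|].
rewrite rmorphM rmorphXn; apply: (subringM HG); first exact: (sub _ (IHs _ (Kp i))).
by apply: (subringX HG); apply: genfield_mem; rewrite map_f // mem_rcons inE eqxx.
Qed.

(** Write p = h g with g = gcd(p, p'). Minimality makes p divide whichever factor vanishes at [z]:
    if it is h, then g is constant by degree; if it is g, then p divides p', which is nonzero of
    smaller degree. *)
Lemma minCpoly_separable z : exists2 p : {poly rat},
  separable_poly p & minCpoly z = map_poly ratr p.
Proof.
have [p [Dp mon_p] dv_p] := minCpolyP z; exists p => //.
have nz_p := monic_neq0 mon_p; have sz_p : (1 < size p)%N.
  by rewrite -(size_map_poly (@ratr algC)) -Dp size_minCpoly.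
have rz : root (map_poly ratr p) z by rewrite -Dp root_minCpoly.
have nz_dp : p^`() != 0.
  apply/eqP=> /(congr1 (fun q : {poly rat} => q`_(size p).-2)).
  rewrite coef_deriv coef0; move: (monicP mon_p); rewrite /lead_coef.
  case: (size p) sz_p => [|[|n]] //= _.
  by move=> ->; apply/eqP; rewrite pnatr_eq0.
rewrite unlock /coprimep; set g := gcdp _ _.
have [h Dgh] := dvdpP _ _ (dvdp_gcdl p p^`()).
have nz_gh : h * g != 0 by rewrite -Dgh.
have [nz_h nz_g] : h != 0 /\ g != 0 by apply/andP; rewrite -negb_or -mulf_eq0.
move: rz; rewrite {1}Dgh -/g rmorphM rootM => /orP[]; rewrite dv_p => dv.
  have := dvdp_leq nz_h dv; rewrite Dgh -/g size_mul //.
  have : (0 < size g)%N by rewrite lt0n size_poly_eq0.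
  by case: (size g) => [|[|n]] // _; rewrite !addnS /= -ltn_subRL subnn.
have : p %| p^`() by apply: dvdp_trans dv (dvdp_gcdr _ _).
by move/(dvdp_leq nz_dp); rewrite leqNgt lt_size_deriv.
Qed.

(** Applied to all roots of the minimal polynomial of a primitive element of [S], [num_field_exists]
    yields the splitting field of that polynomial, hence a Galois extension of the rationals. *)
Lemma galois_num_field (S : seq algC) :
  exists2 L : splittingFieldType rat, galois 1 {:L} &
  exists (LC : {rmorphism L -> algC}) (sL : seq L), map LC sL = S.
Proof.
have [z _ [ps Dps]] := algC_PET S.
have [p sep_p Dp] := minCpoly_separable z.
have [r Dr] := closed_field_poly_normal (minCpoly z).
rewrite (monicP (minCpoly_monic z)) scale1r in Dr.
have rz : z \in r by rewrite -root_prod_XsubC -Dr root_minCpoly.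
have [L [LC [rr Drr genL]]] := num_field_exists r.
have LC_poly q : map_poly LC (map_poly (in_alg L) q) = map_poly ratr q.
  rewrite -map_poly_comp; apply: eq_map_poly => a.
  by rewrite /= rmorphZ_num rmorph1 mulr1.
pose pL := map_poly (in_alg L) p.
have pL1 : pL \is a polyOver 1%VS.
  by apply/polyOverP=> i; rewrite coef_map memvZ ?memv_line.
have splitL : splittingFieldFor 1 pL {:L}.
  exists rr => //; congr (_ %= _): (eqpxx pL); apply/(map_poly_inj LC).
  rewrite LC_poly -Dp Dr -Drr big_map rmorph_prod /=; apply: eq_bigr => y _.
  by rewrite map_polyXsubC.
have L_ax : FieldExt_isSplittingField _ L by constructor; exists pL.
pose Ln := HB.pack_for (splittingFieldType rat) L L_ax.
exists Ln.
  by apply/splitting_galoisField; exists pL; rewrite separable_map.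
have [zz Dz] : exists zz, LC zz = z.
  by move: rz; rewrite -Drr => /mapP[zz _ ->]; exists zz.
exists LC, [seq (map_poly (in_alg L) q).[zz] | q <- ps].
rewrite Dps -map_comp; apply: eq_map => q.
by rewrite /= -horner_map Dz LC_poly.
Qed.

(** By the Galois correspondence some automorphism of [L] moves the preimage of [x], and it extends
    to algC. Every automorphism other than [tau] originates here; read backwards, it proves
    membership in a subfield. *)
Lemma genfield_moved S x : ~ genfield S x ->
  exists2 f : {rmorphism algC -> algC}, {in S, forall s, f s = s} & f x <> x.
Proof.
move=> S'x; have [Ln galL [LC [[|xx sL] // [Dx DS]]]] := galois_num_field (x :: S).
have galE : galois <<1 & sL>> {:Ln}.
  by apply: galoisS galL; rewrite subvf sub1v.
have E'xx : xx \notin <<1 & sL>>%VS.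
  by apply/negP=> /(@genfield_alg _ LC); rewrite Dx DS.
move: E'xx; rewrite -(galois_fixedField galE) => /negP E'xx.
have [f [fE fx]] : exists f, f \in 'Gal({:Ln} / <<1 & sL>>)%g /\ f xx != xx.
  apply: NNPP => nof; apply: E'xx; apply/fixedFieldP; first exact: memvf.
  by move=> f fE; apply/eqP/negPn/negP=> fx; apply: nof; exists f.
have [nu Dnu] := extend_algC_subfield_aut LC f.
exists nu.
  move=> s; rewrite -DS => /mapP[y sy ->]; rewrite -Dnu; congr (LC _).
  by apply: fixed_gal fE _; rewrite ?subvf // seqv_sub_adjoin.
by rewrite -Dx -Dnu => /fmorph_inj/eqP; apply/negP.
Qed.

(** * Cube roots of unity and cubic Kummer extensions *)

Lemma sqrtm3_sqr : sqrtm3 ^+ 2 = -3.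
Proof. by rewrite /sqrtm3 exprMn sqrCi sqrtCK mulN1r. Qed.

Lemma sqrtm3E : sqrtm3 = 2 * zeta3 + 1.
Proof. by rewrite /zeta3 mulrC divfK ?pnatr_eq0 //; ring. Qed.

Lemma zeta3_sqr : zeta3 ^+ 2 = - zeta3 - 1.
Proof.
have := sqrtm3_sqr; rewrite sqrtm3E => e; apply: (@mulfI _ 4) => //.
  by rewrite pnatr_eq0.
have -> : 4 * zeta3 ^+ 2 = (2 * zeta3 + 1) ^+ 2 - 4 * zeta3 - 1 by ring.
by rewrite e; ring.
Qed.

Lemma zeta3_cube : zeta3 ^+ 3 = 1.
Proof. by rewrite exprS zeta3_sqr mulrBr mulrN -expr2 zeta3_sqr; ring. Qed.

Lemma zeta3_neq1 : zeta3 - 1 != 0.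
Proof.
apply/eqP=> /subr0_eq z1; have := zeta3_sqr; rewrite z1 => /eqP.
by rewrite -subr_eq0 (_ : _ - _ = 3%:R) ?pnatr_eq0 //; ring.
Qed.

Lemma zeta3_neq0 : zeta3 != 0.
Proof.
apply/eqP=> z0; have := zeta3_cube; rewrite z0 expr0n /= => /eqP.
by rewrite eq_sym oner_eq0.
Qed.

Lemma zeta3_mul3 x : zeta3 * (zeta3 * (zeta3 * x)) = x.
Proof. by rewrite -[RHS]mul1r -zeta3_cube; ring. Qed.

Lemma zeta3_mod n : zeta3 ^+ (n %% 3) = zeta3 ^+ n.
Proof. by rewrite {2}(divn_eq n 3) exprD mulnC exprM zeta3_cube expr1n mul1r. Qed.

(** Up to sign the modulus of the congruences is a cube, which is the form in which it serves
    later. *)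
Lemma subr1_zeta3_cube : (1 - zeta3) ^+ 3 = - (3 * sqrtm3).
Proof.
rewrite sqrtm3E; transitivity (1 - 3 * zeta3 + 3 * zeta3 ^+ 2 - zeta3 ^+ 3).
  ring.
by rewrite zeta3_cube zeta3_sqr; ring.
Qed.

Lemma subr1_zeta3_sqr : (1 - zeta3) ^+ 2 = - 3 * zeta3.
Proof.
transitivity (1 - 2 * zeta3 + zeta3 ^+ 2); first by ring.
by rewrite zeta3_sqr; ring.
Qed.

#[global] Opaque zeta3 sqrtm3.

Lemma eq_cube (x y : algC) : x ^+ 3 = y ^+ 3 -> exists2 i : nat, (i < 3)%N & x = zeta3 ^+ i * y.
Proof.
move/eqP; rewrite -subr_eq0.
have -> : x ^+ 3 - y ^+ 3 = (x - y) * ((x - zeta3 * y) * (x - zeta3 ^+ 2 * y)).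
  transitivity (x ^+ 3 - (1 + zeta3 + zeta3 ^+ 2) * (x ^+ 2 * y)
     + (zeta3 + zeta3 ^+ 2 + zeta3 ^+ 3) * (x * y ^+ 2) - zeta3 ^+ 3 * y ^+ 3).
    by rewrite zeta3_cube zeta3_sqr; ring.
  by ring.
rewrite !mulf_eq0 => /or3P[] /eqP/subr0_eq ->.
- by exists 0%N; rewrite ?mul1r.
- by exists 1%N.
- by exists 2%N.
Qed.

(** * Integrality of roots of monic cubics *)

Lemma Aint_integral x : x \in Aint <-> integralOver (intr : int -> algC) x.
Proof.
split=> [Ax | [p mon_p rpx]].
  have /floorpP[p Dp] : minCpoly x \is a polyOver Num.int by [].
  exists p; last by rewrite -Dp root_minCpoly.
  have := minCpoly_monic x; rewrite Dp monicE lead_coef_map_inj //; last exact: intr_inj.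
  by rewrite -[1]/(1%:~R) eqr_int.
apply: root_monic_Aint rpx _ _; first exact: monic_map.
by apply/polyOverP=> i; rewrite coef_map /= intr_int.
Qed.

Lemma Aint_cubic (y a b c : algC) : a \in Aint -> b \in Aint -> c \in Aint ->
  y ^+ 3 + a * y ^+ 2 + b * y + c = 0 -> y \in Aint.
Proof.
move=> /Aint_integral Ia /Aint_integral Ib /Aint_integral Ic y0; apply/Aint_integral.
have sz : Poly [:: c; b; a; 1] = [:: c; b; a; 1] :> seq algC.
  by rewrite (PolyK (c := 0)) //= oner_eq0.
apply: (integral_root_monic (p := Poly [:: c; b; a; 1])).
- by rewrite monicE lead_coefE sz.
- by rewrite /root -y0 horner_Poly /=; apply/eqP; ring.
- move=> u; rewrite sz !inE => /or4P[] /eqP -> //; exact: integral1.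
Qed.

Lemma Aint_cube (y : algC) : y ^+ 3 \in Aint -> y \in Aint.
Proof.
by move=> Ay; apply: (@Aint_cubic y 0 0 (- y ^+ 3)); rewrite ?rpredN //; ring.
Qed.

Lemma zeta3_Aint : zeta3 \in Aint.
Proof. by apply: Aint_cube; rewrite zeta3_cube. Qed.

Section Kummer.
Variables (F : algC -> Prop) (b : algC) (s : {rmorphism algC -> algC}).
Hypotheses (HF : is_subfield F) (Fz : F zeta3) (Fb : F (b ^+ 3)).
Hypotheses (sF : forall x, F x -> s x = x) (sb : s b = zeta3 * b).

Let HR : is_subring F := subfield_subring HF.

(** F(b) as the span of 1, b, b^2. Every computation starts from some such expression, so uniqueness
    of the coordinates never enters. *)
Definition kummer_span x :=
  exists c0 c1 c2, [/\ F c0, F c1, F c2 & x = c0 + c1 * b + c2 * b ^+ 2].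

Lemma kummer_span_mem x : F x -> kummer_span x.
Proof. by exists x, 0, 0; split => //; [mem HR | mem HR | ring]. Qed.

Lemma kummer_span_subfield : is_subfield kummer_span.
Proof.
split=> [||x y [c0 [c1 [c2 [F0 F1 F2 ->]]]] [d0 [d1 [d2 [E0 E1 E2 ->]]]]
          |x y [c0 [c1 [c2 [F0 F1 F2 ->]]]] [d0 [d1 [d2 [E0 E1 E2 ->]]]]
          |x [c0 [c1 [c2 [F0 F1 F2 Dx]]]]].
- by apply: kummer_span_mem; mem HR.
- by apply: kummer_span_mem; mem HR.
- by exists (c0 - d0), (c1 - d1), (c2 - d2); split; [mem HR | mem HR | mem HR | ring].
- exists (c0 * d0 + (c1 * d2 + c2 * d1) * b ^+ 3),
    (c0 * d1 + c1 * d0 + c2 * d2 * b ^+ 3), (c0 * d2 + c1 * d1 + c2 * d0).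
  by split; [mem HR | mem HR | mem HR | ring].
have [-> | nz_x] := eqVneq x 0; first by rewrite invr0; apply: kummer_span_mem; mem HR.
(* The norm of [x] as a polynomial in the coordinates and b^3. The inverse of [x] is s(x) s^2(x) /
   N, and the coordinates of s(x) s^2(x) are the numerators of the witnesses below. *)
pose N := c0 ^+ 3 + c1 ^+ 3 * b ^+ 3 + c2 ^+ 3 * (b ^+ 3) ^+ 2 - 3 * c0 * c1 * c2 * b ^+ 3.
have DN : N = x * (s x * s (s x)).
  have E := (rmorphD s, rmorphM s, rmorphXn s, sF F0, sF F1, sF F2, sF Fz, sb).
  rewrite Dx !E /N.
  (* Each sum of powers of [zeta3] is kept as a separate factor, so that rewriting the relations of
     [zeta3] cancels the cross terms before [ring]. *)
  transitivity (c0 ^+ 3 + c1 ^+ 3 * b ^+ 3 * zeta3 ^+ 3 +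
     c2 ^+ 3 * (b ^+ 3) ^+ 2 * (zeta3 ^+ 3) ^+ 2
     + (1 + zeta3 + zeta3 ^+ 2) * (c0 ^+ 2 * c1 * b)
     + (1 + zeta3 ^+ 2 + zeta3 ^+ 3 * zeta3) * (c0 ^+ 2 * c2 * b ^+ 2)
     + zeta3 * (1 + zeta3 + zeta3 ^+ 2) * (c0 * c1 ^+ 2 * b ^+ 2)
     + zeta3 ^+ 2 * (1 + zeta3 ^+ 2 + zeta3 * zeta3 ^+ 3) * (c0 * c2 ^+ 2 * b ^+ 4)
     + (zeta3 * (1 + zeta3 ^+ 3 *+ 2) + zeta3 ^+ 2 * (zeta3 ^+ 3 + 2)) * (c0 * c1 * c2 * b ^+ 3)
     + zeta3 ^+ 3 * (1 + zeta3 + zeta3 ^+ 2) * (c1 ^+ 2 * c2 * b ^+ 4)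
     + zeta3 ^+ 3 * zeta3 * (1 + zeta3 + zeta3 ^+ 2) * (c1 * c2 ^+ 2 * b ^+ 5)).
    by rewrite zeta3_cube zeta3_sqr; ring.
  by ring.
have nz_N : N != 0 by rewrite DN !mulf_neq0 // ?fmorph_eq0.
have FN : F N^-1 by apply: subfieldV => //; rewrite /N; mem HR.
exists ((c0 ^+ 2 - c1 * c2 * b ^+ 3) / N), ((c2 ^+ 2 * b ^+ 3 - c0 * c1) / N),
  ((c1 ^+ 2 - c0 * c2) / N).
split; [by mem HR | by mem HR | by mem HR |].
apply: (mulfI nz_x); rewrite mulfV //; apply: (mulIf nz_N).
transitivity (x * (c0 ^+ 2 - c1 * c2 * b ^+ 3 + (c2 ^+ 2 * b ^+ 3 - c0 * c1) * b +
   (c1 ^+ 2 - c0 * c2) * b ^+ 2)); last by field.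
by rewrite Dx mul1r /N; ring.
Qed.

Lemma kummer_genfield S : (forall x, x \in S -> F x \/ x = b) ->
  forall x, genfield S x -> kummer_span x.
Proof.
move=> SFb; apply: genfield_min kummer_span_subfield _ => x /SFb[/kummer_span_mem // | ->].
by exists 0, 1, 0; split; [mem HR | mem HR | mem HR | ring].
Qed.

Lemma kummer_trace c0 c1 c2 x : F c0 -> F c1 -> F c2 -> 
  x = c0 + c1 * b + c2 * b ^+ 2 -> x + s x + s (s x) = 3 * c0.
Proof.
move=> F0 F1 F2 ->.
rewrite !(rmorphD s, rmorphM s, rmorphXn s, sF F0, sF F1, sF F2, sF Fz, sb).
transitivity (3 * c0 + (1 + zeta3 + zeta3 ^+ 2) * (c1 * b) +
  (1 + zeta3 ^+ 2 + zeta3 ^+ 3 * zeta3) * (c2 * b ^+ 2)); first by ring.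
by rewrite zeta3_cube zeta3_sqr; ring.
Qed.

Lemma kummer_traceF x : kummer_span x -> F (x + s x + s (s x)).
Proof.
by case=> c0 [c1 [c2 [F0 F1 F2 /kummer_trace ->]]] //; mem HR.
Qed.

Lemma kummer_fixed x : kummer_span x -> s x = x -> F x.
Proof.
move=> Kx sx; have := kummer_traceF Kx; rewrite !sx => Ft.
have -> : x = (x + x + x) / 3 by field.
by apply: subringM => //; apply: subfieldV => //; mem HR.
Qed.

Lemma kummer_order3 x : kummer_span x -> s (s (s x)) = x.
Proof.
case=> c0 [c1 [c2 [F0 F1 F2 ->]]].
rewrite !(rmorphD s, rmorphM s, rmorphXn s, sF F0, sF F1, sF F2, sF Fz, sb).
transitivity (c0 + zeta3 ^+ 3 * (c1 * b) + (zeta3 ^+ 3) ^+ 2 * (c2 * b ^+ 2)).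
  ring.
by rewrite zeta3_cube; ring.
Qed.

End Kummer.

(** * Ideals of rings of algebraic integers *)

Section Ideals.
Variables (O : algC -> Prop) (HO : is_subring O).

Lemma subring_ideal : is_ideal O O.
Proof.
by split => //; [apply: subring0 | move=> *; apply: subringD
  | move=> *; apply: subringM].
Qed.

Lemma ideal_gen_ideal S : (forall x, S x -> O x) -> is_ideal O (ideal_gen O S).
Proof.
move=> SO; split=> [x | I [] // | x y Ix Iy I HI SI | r x Or Ix I HI SI].
- by apply=> //; apply: subring_ideal.
- by case: (HI) => _ _ h _; apply: h; [apply: Ix | apply: Iy].
- by case: (HI) => _ _ _; apply; last apply: Ix.
Qed.

Lemma pidealP a x : O a -> pideal O a x <-> exists2 r, O r & x = a * r.
Proof.
move=> Oa; split=> [Ix | [r Or ->] I [_ _ _ h] Ia]; last by rewrite mulrC; apply/h/Ia.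
apply: (Ix (fun x => exists2 r, O r & x = a * r)) => [|_ ->]; last first.
  by exists 1; [mem HO | rewrite mulr1].
split=> [_ [r Or ->]||_ _ [r Or ->] [t Ot ->]|r _ Or [t Ot ->]].
- by mem HO.
- by exists 0; [mem HO | rewrite mulr0].
- by exists (r + t); [mem HO | rewrite mulrDr].
- by exists (r * t); [mem HO | rewrite mulrCA].
Qed.

Lemma ideal_mul_ideal I J : is_ideal O I -> is_ideal O J -> is_ideal O (ideal_mul O I J).
Proof.
move=> [IO _ _ _] [JO _ _ _]; apply: ideal_gen_ideal => _ [x [y [/IO Ox /JO Oy ->]]].
by mem HO.
Qed.

Lemma ideal_mul_mem (I J : algC -> Prop) x y : I x -> J y -> ideal_mul O I J (x * y).
Proof. by move=> Ix Jy K _; apply; exists x, y. Qed.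

Lemma ideal_mul_min I J K : is_ideal O K -> (forall x y, I x -> J y -> K (x * y)) ->
  forall z, ideal_mul O I J z -> K z.
Proof. by move=> HK IJK z; apply=> // _ [x [y [Ix Jy ->]]]; apply: IJK. Qed.

Lemma ideal_exp_ideal I n : is_ideal O I -> is_ideal O (ideal_exp O I n).
Proof.
by move=> HI; elim: n => [|n IHn]; [apply: subring_ideal | apply: ideal_mul_ideal].
Qed.

Lemma ideal_expX (I : algC -> Prop) x n : I x -> ideal_exp O I n (x ^+ n).
Proof.
move=> Ix; elim: n => [|n IHn]; first by rewrite expr0 /=; mem HO.
by rewrite exprSr; apply: ideal_mul_mem.
Qed.

(** Lets an induction over a product of ideals treat one factor at a time: the condition on the
    other factor is itself an ideal, so it can be tested on generators. *)
Lemma ideal_colon K y : is_ideal O K -> O y -> is_ideal O (fun x => O x /\ K (x * y)).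
Proof.
move=> [KO K0 KD KM] Oy; split=> [x []||x z [Ox Kx] [Oz Kz]|r x Or [Ox Kx]] //.
- by rewrite mul0r; split; [mem HO |].
- by rewrite mulrDl; split; [mem HO | apply: KD].
- by rewrite -mulrA; split; [mem HO | apply: KM].
Qed.

Lemma ideal_exp_add_mem I m n x y : is_ideal O I ->
  ideal_exp O I m x -> ideal_exp O I n y -> ideal_exp O I (m + n) (x * y).
Proof.
move=> HI Imx; elim: n y => [|n IHn] y Iny.
  have [_ _ _ h] := ideal_exp_ideal m HI.
  by rewrite addn0 mulrC; apply: h.
have [mO _ _ _] := ideal_exp_ideal m HI.
suff [] : O y /\ ideal_exp O I (m + n.+1) (y * x) by rewrite mulrC.
apply: (ideal_mul_min (K := fun y => O y /\ ideal_exp O I (m + n.+1) (y * x)) _ _ Iny)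
  => [|u v Inu Iv].
  by apply: ideal_colon; [apply: ideal_exp_ideal | apply: mO].
have [nO _ _ _] := ideal_exp_ideal n HI; case: (HI) => IO _ _ _.
split; first by have := nO _ Inu; have := IO _ Iv => *; mem HO.
rewrite mulrC mulrA addnS; apply: ideal_mul_mem => //; exact: IHn.
Qed.

(** [ideal_exp] peels off a single factor at a time; this elimination rule is what later splits
    B^(3m) into three factors B^m. *)
Lemma ideal_exp_add_min I K m n : is_ideal O I -> is_ideal O K ->
  (forall x y, ideal_exp O I m x -> ideal_exp O I n y -> K (x * y)) ->
  forall z, ideal_exp O I (m + n) z -> K z.
Proof.
move=> HI; elim: n K => [|n IHn] K HK mnK.
  by move=> z; rewrite addn0 => Iz; rewrite -(mulr1 z); apply: mnK => //=; mem HO.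
rewrite addnS; apply: ideal_mul_min => // x y Ix Iy.
have Oy : O y by case: HI => IO _ _ _; apply: IO.
suff [] : O x /\ K (x * y) by [].
apply: (IHn (fun x => O x /\ K (x * y))) Ix; first exact: ideal_colon.
move=> u v Iu Iv; split; last by rewrite -mulrA; apply: mnK => //; apply: ideal_mul_mem.
have [h1 _ _ _] := ideal_exp_ideal m HI; have [h2 _ _ _] := ideal_exp_ideal n HI.
by apply: subringM => //; [apply: h1 | apply: h2].
Qed.

(** The localization at a prime is never formed: [d] is the denominator that clears it, and
    denominators multiply along a power of the ideal. *)
Lemma ideal_exp_scale I K d u n : is_ideal O I -> is_ideal O K -> O d -> O u ->
  (forall x, I x -> exists2 r, O r & d * x = u * r) ->
  forall x, ideal_exp O I n x -> exists2 r, O r & d ^+ n * x = u ^+ n * r.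
Proof.
move=> HI HK Od Ou dI; elim: n => [|n IHn] x.
  by move=> Ox; exists x; rewrite ?expr0.
move=> Ix; suff [] : O x /\ exists2 r, O r & d ^+ n.+1 * x = u ^+ n.+1 * r by [].
apply: (ideal_mul_min (K := fun x => O x /\
  exists2 r, O r & d ^+ n.+1 * x = u ^+ n.+1 * r) _ _ Ix) => [|y z Iy Iz].
  split=> [y [] //||y z [Oy [r Or Ey]] [Oz [t Ot Ez]]|t y Ot [Oy [r Or Ey]]].
  - by split; [mem HO | exists 0; [mem HO | rewrite !mulr0]].
  - split; first by mem HO.
    by exists (r + t); [mem HO | rewrite !mulrDr Ey Ez].
  - split; first by mem HO.
    by exists (t * r); [mem HO | rewrite mulrCA Ey mulrCA].
have [nO _ _ _] := ideal_exp_ideal n HI; case: (HI) => IO _ _ _.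
have Oy := nO _ Iy; have Oz := IO _ Iz; split; first by mem HO.
have [r Or Er] := IHn _ Iy; have [t Ot Et] := dI _ Iz.
exists (r * t); first by mem HO.
by rewrite !exprSr mulrACA Er Et mulrACA.
Qed.

End Ideals.

Section Prime.
Variables (O q : algC -> Prop) (HO : is_subring O) (Hq : is_prime_ideal O q).

Lemma prime_sub x : q x -> O x. Proof. by case: Hq => -[h _ _ _] _ _; apply: h. Qed.
Lemma prime0 : q 0. Proof. by case: Hq => -[]. Qed.
Lemma primeD x y : q x -> q y -> q (x + y).
Proof. by case: Hq => -[_ _ h _] _ _; apply: h. Qed.
Lemma primeMr r x : O r -> q x -> q (r * x).
Proof. by case: Hq => -[_ _ _ h] _ _; apply: h. Qed.
Lemma primeMl r x : O r -> q x -> q (x * r).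
Proof. by rewrite mulrC; apply: primeMr. Qed.
Lemma primeN x : q x -> q (- x).
Proof. by rewrite -mulN1r; apply: primeMr; mem HO. Qed.
Lemma primeB x y : q x -> q y -> q (x - y).
Proof. by move=> qx qy; apply: primeD => //; apply: primeN. Qed.
Lemma prime1 : ~ q 1. Proof. by case: Hq. Qed.
Lemma prime_mulP x y : O x -> O y -> q (x * y) -> q x \/ q y.
Proof. by case: Hq => _ _; apply. Qed.
Lemma prime_notM x y : O x -> O y -> ~ q x -> ~ q y -> ~ q (x * y).
Proof. by move=> Ox Oy nx ny /(prime_mulP Ox Oy)[]. Qed.
Lemma prime_notX x n : O x -> ~ q x -> ~ q (x ^+ n).
Proof.
move=> Ox nx; elim: n => [|n IHn]; first by rewrite expr0; apply: prime1.
by rewrite exprS; apply: prime_notM => //; mem HO.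
Qed.
Lemma primeX x n : O x -> q (x ^+ n) -> q x.
Proof. by move=> Ox qxn; apply: NNPP => /(prime_notX (n := n) Ox). Qed.

(** If u^e were in q^(e+1), scaling would give d^(e+1) u^e = u^(e+1) r, and cancelling u^e would put
    d^(e+1) in q. The hypotheses play the part of v_q(u) = 1. *)
Lemma prime_colon_exp_not d u e : O d -> O u -> ~ q d -> q u -> u != 0 ->
  (forall x, q x -> exists2 r, O r & d * x = u * r) ->
  ~ ideal_exp O q e.+1 (u ^+ e).
Proof.
move=> Od Ou qd qu nz_u dq qe; case: (Hq) => HI _ _.
have [r Or] := ideal_exp_scale HO HI HI Od Ou dq qe.
move=> E; have {}E : d ^+ e.+1 = u * r.
  by apply: (mulfI (expf_neq0 e nz_u)); rewrite mulrC E [u ^+ e.+1]exprSr mulrA.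
have : q (d ^+ e.+1) by rewrite E; apply: primeMl.
exact: prime_notX.
Qed.

(* With T the trace of s,
   (y - s y)(y - s^2 y) w = T(y^2 w) - (s y + s^2 y) T(y w) + s y s^2 y T(w),
   so w is, up to a factor outside q, a combination of elements of the base ring. *)
Lemma unramified_step (O0 : algC -> Prop) (s : {rmorphism algC -> algC}) y c u :
    (forall x, O x -> O (s x)) -> (forall x, O x -> s (s (s x)) = x) ->
    (forall x, O x -> O0 (x + s x + s (s x))) ->
    O y -> ~ q (y - s y) -> ~ q (y - s (s y)) ->
    O c -> ~ q c -> O u ->
    (forall x, O0 x -> q x -> exists2 r, O r & c * x = u * r) ->
  exists2 d, O d /\ ~ q d & forall x, q x -> exists2 r, O r & d * x = u * r.
Proof.
move=> sO s3 sT Oy y1 y2 Oc qc Ou cq.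
(* The traces below must lie in [q], so the conjugates of v x have to be in [q] too. If [q] is not
   stable under [s], elements v1, v2 outside [q] with s v1 and s^2 v2 in [q] exist, and v = v1 v2
   works for every [x]. *)
have [v [Ov qv qs]] : exists v, [/\ O v, ~ q v &
    forall x, q x -> q (s (v * x)) /\ q (s (s (v * x)))].
  have [qs | /not_all_ex_not[w /(imply_to_and (q w))[qw qsw]]] :=
      classic (forall x, q x -> q (s x)).
    exists 1; split; [by mem HO | exact: prime1 |].
    by move=> x qx; rewrite mul1r; split; [apply/qs | apply/qs/qs].
  have Ow := prime_sub qw.
  (* Otherwise s v in q would always imply v in q; since s^3 w = w is in q, two such implications
     would put s w in q. *)
  have [v1 [Ov1 qv1 sv1]] : exists v, [/\ O v, ~ q v & q (s v)].
    apply: NNPP => no; apply: qsw.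
    have back v : O v -> q (s v) -> q v.
      by move=> Ov qsv; apply: NNPP => nqv; apply: no; exists v.
    by apply/(back _ (sO _ Ow))/(back _ (sO _ (sO _ Ow))); rewrite s3.
  have [v2 [Ov2 qv2 sv2]] : exists v, [/\ O v, ~ q v & q (s (s v))].
    apply: NNPP => no; apply: no; exists (s w).
    by split; rewrite ?s3 //; apply: sO => //.
  exists (v1 * v2); split; [by mem HO | exact: prime_notM |].
  move=> x /prime_sub Ox; rewrite !rmorphM; split.
    by apply: primeMl (primeMl (sO _ Ov2) sv1); apply/sO.
  by apply: primeMl (primeMr (sO _ (sO _ Ov1)) sv2); apply/sO/sO.
pose y' := s y; pose y'' := s y'.
have [Oy' Oy''] : O y' /\ O y'' by split; [apply: sO | apply/sO/sO].
exists (c * ((y - y') * (y - y'')) * v).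
  split; first by mem HO.
  apply: prime_notM => //; first by mem HO.
  by apply: prime_notM => //; [mem HO | apply: prime_notM => //; mem HO].
move=> x qx; have [qs1 qs2] := qs x qx; have Ox := prime_sub qx.
have qvx : q (v * x) by apply: primeMr.
pose T z := z + s z + s (s z).
have TP z : O z -> exists2 r, O r & c * T (z * (v * x)) = u * r.
  move=> Oz; apply: cq; first by apply: sT; mem HO.
  rewrite /T (rmorphM s z) (rmorphM s (s z)).
  apply: primeD; first apply: primeD; apply: primeMr => //.
    exact/sO.
  exact/sO/sO.
have [r1 Or1 E1] : exists2 r, O r & c * T (y ^+ 2 * (v * x)) = u * r by apply: TP; mem HO.
have [r2 Or2 E2] := TP y Oy.
have [r3 Or3 E3] : exists2 r, O r & c * T (1 * (v * x)) = u * r by apply: TP; mem HO.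
exists (r1 - (y' + y'') * r2 + y' * y'' * r3); first by mem HO.
transitivity (u * r1 - (y' + y'') * (u * r2) + y' * y'' * (u * r3)); last by ring.
rewrite -E1 -E2 -E3 /T !(rmorphM s, rmorphXn s, rmorph1 s) -/y' -/y''; ring.
Qed.

End Prime.

(** * Nonzero primes of rings of integers are maximal *)

Section PrimeInts.
Variables (F q : algC -> Prop) (HF : is_subfield F) (Hq : is_prime_ideal (ints F) q).
Let HO := ints_subring HF.

(** [c] is the lowest nonzero coefficient of a monic integer equation of [x]: factors X are stripped
    off until the constant term is nonzero. *)
Lemma ints_Aint_root x : ints F x -> x != 0 -> exists2 c : int, c%:~R != 0 :> algC &
  exists2 y, ints F y & c%:~R = x * y.
Proof.
move=> Ox nz_x; have [_ /Aint_integral[p mon_p px0]] := Ox.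
elim/poly_ind: p mon_p px0 => [/monic_neq0/eqP // | p c IHp].
have [-> | nz_p] := eqVneq p 0.
  rewrite mul0r add0r => mon_c; rewrite map_polyC rootC /= intr_eq0 => /eqP c0.
  by move: (monic_neq0 mon_c); rewrite c0 polyC0 eqxx.
have sz : (size (c%:P : {poly int})%R < size (p * 'X)%R)%N.
  by rewrite size_mulX // ltnS (leq_trans (size_polyC_leq1 c)) ?lt0n ?size_poly_eq0.
rewrite monicE lead_coefDl // lead_coefMX -monicE => mon_p.
rewrite /root rmorphD rmorphM /= map_polyX map_polyC hornerMXaddC /=.
have [-> | nz_c] := eqVneq c 0.
  by rewrite addr0 mulf_eq0 (negPf nz_x) orbF => /IHp; apply.
move=> /eqP E; exists c; first by rewrite intr_eq0.
exists (- (map_poly intr p).[x]); last by apply/eqP; rewrite mulrN mulrC -addr_eq0 addrC E.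
apply: (subringN HO); rewrite horner_coef.
elim/big_ind: _ => [||i _]; [exact: (subring0 HO) | by move=> *; apply: (subringD HO) |].
by rewrite coef_map /=; mem HO.
Qed.

Lemma prime_int : (exists2 x, q x & x != 0) ->
  exists2 l : nat, prime l & q l%:R.
Proof.
case=> x qx nz_x; have Ox := prime_sub Hq qx.
have [c nz_c [y Oy Dc]] := ints_Aint_root Ox nz_x.
have qc : q c%:~R by rewrite Dc; apply: (primeMl Hq).
have qn : q (`|c|%N)%:R.
  by case: (c) qc => n //; rewrite NegzE rmorphN => /(primeN HO Hq); rewrite opprK.
have : (0 < `|c|)%N by rewrite absz_gt0 -(intr_eq0 algC).
move: `|c|%N qn => n; elim/ltn_ind: n => n IHn qn n_gt0.
have [n1 | n_gt1] := leqP n 1.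
  case: (prime1 Hq); rewrite (_ : 1 = n%:R) //.
  by case: n n1 n_gt0 {IHn qn} => [|[]].
have p_pr := pdiv_prime n_gt1; have dv := pdiv_dvd n.
move: qn; rewrite -(divnK dv) natrM => /(prime_mulP Hq (subring_nat HO _) (subring_nat HO _)).
case=> [qd | qp]; last by exists (pdiv n).
apply: IHn qd _; first by rewrite ltn_Pdiv // prime_gt1.
by rewrite divn_gt0 ?pdiv_gt0 // dvdn_leq.
Qed.

Lemma prime_inverse a : (exists2 x, q x & x != 0) -> ints F a -> ~ q a ->
  exists2 v, ints F v & q (a * v - 1).
Proof.
move=> /prime_int[l pr_l ql] Oa nqa.
have intV (c : int) : ~ q c%:~R -> exists2 v, ints F v & q (c%:~R * v - 1).
  move=> nqc; have [[u v] Duv] : exists uv : int * int, uv.1 * c + uv.2 * l%:Z = 1.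
    have cop : coprimez c l.
      rewrite coprimezE coprime_sym prime_coprime //.
      apply/negP=> dv; have /dvdzP : (l%:Z %| c)%Z by [].
      case=> d Dc; apply: nqc.
      by rewrite Dc rmorphM; exact: (primeMr Hq (subring_int HO d) ql).
    by have [u v] := coprimezP _ _ cop; exists u.
  exists u%:~R; first by mem HO.
  have /(congr1 (intr : int -> algC)) := Duv; rewrite rmorphD !rmorphM rmorph1 /= => D1.
  have swap (x y z w : algC) : x * y + z * w = 1 -> y * x - 1 = - (z * w).
    by move=> <-; ring.
  rewrite (swap _ _ _ _ D1).
  exact: (primeN HO Hq (primeMr Hq (subring_int HO v) ql)).
have [_ /Aint_integral[p mon_p /eqP pa0]] := Oa.
have qpa : q (map_poly intr p).[a] by rewrite pa0; apply: (prime0 Hq).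
elim/poly_ind: p mon_p qpa {pa0} => [/monic_neq0/eqP // | p c IHp].
have Opa (r : {poly int}) : ints F (map_poly intr r).[a].
  rewrite horner_coef.
  elim/big_ind: _ => [||i _]; [exact: (subring0 HO) | by move=> *; apply: (subringD HO) |].
  by rewrite coef_map /=; mem HO.
have [-> | nz_p] := eqVneq p 0.
  rewrite mul0r add0r monicE lead_coefC => /eqP ->.
  by rewrite map_polyC hornerC => /(prime1 Hq).
have sz : (size (c%:P : {poly int})%R < size (p * 'X)%R)%N.
  by rewrite size_mulX // ltnS (leq_trans (size_polyC_leq1 c)) ?lt0n ?size_poly_eq0.
rewrite monicE lead_coefDl // lead_coefMX -monicE => mon_p.
rewrite rmorphD rmorphM /= map_polyX map_polyC hornerMXaddC /= => qE.
have [qc | /intV[v Ov qv]] := classic (q c%:~R).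
  apply: IHp => //; have := primeB HO Hq qE qc; rewrite addrK.
  by case/(prime_mulP Hq (Opa p) Oa).
exists (- (map_poly intr p).[a] * v); first by have := Opa p => Opa'; mem HO.
rewrite (_ : _ - 1 = (c%:~R * v - 1) - v * ((map_poly intr p).[a] * a + c%:~R)); last by ring.
by apply: (primeB HO Hq) => //; apply: (primeMr Hq).
Qed.

End PrimeInts.

(** * Primes of the base field *)

Lemma kk_subring : is_subring kk. Proof. exact: genfield_subring. Qed.
Lemma kk_zeta3 : kk zeta3. Proof. by apply: genfield_mem; rewrite inE. Qed.
Lemma Ok_subring : is_subring Ok. Proof. exact/ints_subring/genfield_subfield. Qed.

Lemma fix_kk (f : {rmorphism algC -> algC}) : f zeta3 = zeta3 -> forall x, kk x -> f x = x.
Proof. by move=> fz; apply: fix_genfield => x; rewrite inE => /eqP ->. Qed.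

Lemma kk_genfield S x : zeta3 \in S -> kk x -> genfield S x.
Proof. by move=> Sz; apply: genfield_sub => y; rewrite inE => /eqP ->. Qed.

Section OkPrime.
Variable p : algC.
Hypotheses (Op : Ok p) (nz_p : p != 0) (Hp : is_prime_ideal Ok (pideal Ok p)).

Lemma Ok_prime_ndvd p' : Ok p' -> is_prime_ideal Ok (pideal Ok p') -> p' != 0 ->
  ~ ideal_eq (pideal Ok p) (pideal Ok p') -> ~ pideal Ok p p'.
Proof.
have HO := Ok_subring; move=> Op' Hp' nz_p' neq dv; apply: neq => x.
have [u Ou Dp'] := (pidealP HO p' Op).1 dv.
split=> [/(pidealP HO _ Op)[r Or ->] | /(pidealP HO _ Op')[r Or ->]]; last first.
  by apply/(pidealP HO) => //; exists (u * r); rewrite ?Dp' ?mulrA //; mem HO.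
suff : pideal Ok p' p by move=> h; apply: (primeMl Hp').
have : pideal Ok p' (p * u) by apply/(pidealP HO) => //; exists 1; [mem HO | rewrite -Dp' mulr1].
case/(prime_mulP Hp' Op Ou) => // /(pidealP HO _ Op')[v Ov Du].
case: (prime1 Hp); apply/(pidealP HO) => //; exists v => //.
by apply: (mulfI nz_p'); rewrite mulr1 {1}Dp' Du mulrCA.
Qed.

Lemma Ok_prime_cube_dvd C e : kk C -> e \in Aint -> C ^+ 3 = p * e -> pideal Ok p C.
Proof.
have HO := Ok_subring; have Hk := genfield_subfield [:: zeta3].
move=> kC Ae DC; have OC : Ok C.
  by split=> //; apply: Aint_cube; rewrite DC; apply: rpredM => //; case: Op.
apply: (primeX HO Hp (n := 3)) => //; apply/(pidealP HO) => //; exists e => //; split=> //.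
have -> : e = C ^+ 3 / p by rewrite DC mulrC mulKf.
have [kp _] := Op; have := subfieldV Hk kp; have HR := kk_subring => *; mem HR.
Qed.

(** (C p)^3 is p times the integer C^3 p^n p^(2-n), so p divides C p: with n < 3 there is no room
    for a denominator at p. *)
Lemma Ok_prime_cube C n : kk C -> (n < 3)%N -> C ^+ 3 * p ^+ n \in Aint -> Ok C.
Proof.
have HO := Ok_subring; have Hk := genfield_subfield [:: zeta3].
move=> kC n3 AC; have [kp Ap] := Op.
have : pideal Ok p (C * p).
  apply: (@Ok_prime_cube_dvd _ (C ^+ 3 * p ^+ n * p ^+ (2 - n))).
  - by have HR := kk_subring; mem HR.
  - by apply: rpredM => //; apply: rpredX.
  - by case: n n3 {AC} => [|[|[|n]]] // _; rewrite /subn /=; ring.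
by case/(pidealP HO _ Op) => r Or /eqP; rewrite mulrC (inj_eq (mulfI nz_p)) => /eqP ->.
Qed.
End OkPrime.

Lemma normalized_prime_neq0 p : normalized_prime p -> p != 0.
Proof.
case=> _ _ _ [n [E n1]] _; apply/eqP=> p0; move: E; rewrite p0 mul0r => /esym/eqP.
by rewrite pnatr_eq0 => /eqP n0; rewrite n0 in n1.
Qed.

(** Iterates are built as ring morphisms, so that they can be composed, iterated again and applied
    to products. *)
Fixpoint rmorph_iter (f : {rmorphism algC -> algC}) n : {rmorphism algC -> algC} :=
  if n is n'.+1 then f \o rmorph_iter f n' else idfun.

Lemma rmorph_iterS f n x : rmorph_iter f n.+1 x = f (rmorph_iter f n x).
Proof. by []. Qed.

Lemma rmorph_iter_fix (f : {rmorphism algC -> algC}) n x : f x = x -> rmorph_iter f n x = x.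
Proof. by move=> fx; elim: n => //= n; rewrite /= => ->. Qed.

Lemma rmorph_iter_root (f : {rmorphism algC -> algC}) j n b :
  f zeta3 = zeta3 -> f b = zeta3 ^+ j * b -> rmorph_iter f n b = zeta3 ^+ (j * n) * b.
Proof.
move=> fz fb; elim: n => [|n IHn]; first by rewrite muln0 mul1r.
by rewrite rmorph_iterS IHn rmorphM rmorphXn fz fb mulrA -exprD mulnS addnC.
Qed.

Lemma cube_root_image (f : {rmorphism algC -> algC}) b : f (b ^+ 3) = b ^+ 3 ->
  exists2 i, (i < 3)%N & f b = zeta3 ^+ i * b.
Proof. by rewrite rmorphXn => /eq_cube. Qed.

(** An automorphism moving [b] multiplies it by zeta3^i with i = 1 or 2; as i^2 = 1 modulo 3, its
    iterate of exponent i j multiplies [b] by zeta3^j. *)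
Lemma kummer_aut S b j : genfield S zeta3 -> genfield S (b ^+ 3) -> ~ genfield S b ->
  exists2 f : {rmorphism algC -> algC}, (forall x, genfield S x -> f x = x)
    & f b = zeta3 ^+ j * b.
Proof.
move=> Sz Sb S'b; have [f /fix_genfield fS fb] := genfield_moved S'b.
have [i i3 Dfb] := cube_root_image (fS _ Sb).
exists (rmorph_iter f (i * j)) => [x /fS | ]; first exact: rmorph_iter_fix.
have ii : (i * i %% 3 = 1)%N.
  by case: i i3 Dfb => [|[|[|i]]] // _ E; case: fb; rewrite E mul1r.
by rewrite (rmorph_iter_root _ (fS _ Sz) Dfb) -zeta3_mod mulnA -modnMml ii mul1n zeta3_mod.
Qed.

(** * Local computations *)

(* Since (alpha) = P^a A^3 with A = B^m, some product om g h l with g, h, l in A is alpha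
   times an element outside q; then so is om g^3. *)
Lemma local_cube_factor (O P B q : algC -> Prop) (alpha om s : algC) (a b : nat) :
    is_subring O -> is_ideal O P -> is_ideal O B -> is_prime_ideal O q ->
    O alpha -> alpha != 0 -> (3 %| b)%N ->
    ideal_eq (pideal O alpha) (ideal_mul O (ideal_exp O P a) (ideal_exp O B b)) ->
    ideal_exp O P a om -> O s -> ~ q s ->
    (forall x, ideal_exp O P a x -> exists2 r, O r & s * x = om * r) ->
  exists g w, [/\ O g, O w, ~ q w & alpha * w = om * g ^+ 3].
Proof.
move=> HO HP HB Hq Oal nz_al /dvdnP[m Db] Eal Pom Os nqs Ps.
have [PaO _ _ _] := ideal_exp_ideal HO a HP.
have [BO _ _ _] := ideal_exp_ideal HO m HB.
have Oom := PaO _ Pom.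
have PB p x : ideal_exp O P a p -> ideal_exp O B b x -> exists2 r, O r & p * x = alpha * r.
  by move=> Pp Bx; apply/(pidealP HO) => //; apply/Eal; apply: ideal_mul_mem.
have {}Db : b = (m + m + m)%N by rewrite Db; lia.
have prod3 g h l : ideal_exp O B m g -> ideal_exp O B m h -> ideal_exp O B m l ->
    exists2 r, O r & om * (g * h * l) = alpha * r.
  by move=> Bg Bh Bl; apply: PB; rewrite // Db; do ?apply: ideal_exp_add_mem.
have Kq (e : algC) : O e -> is_ideal O (fun x => O x /\ exists2 v, q v & e * x = alpha * v).
  move=> Oe; split=> [x []||x y [Ox [v qv Ev]] [Oy [w qw Ew]]|r x Or [Ox [v qv Ev]]] //.
  - by split; [mem HO | exists 0; [exact: (prime0 Hq) | rewrite !mulr0]].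
  - split; [by mem HO | exists (v + w); first exact: (primeD Hq)].
    by rewrite !mulrDr Ev Ew.
  - split; [by mem HO | exists (r * v); first exact: (primeMr Hq)].
    by rewrite mulrCA Ev mulrCA.
have [g [h [l [v [Bg Bh Bl [Ov nqv Ev]]]]]] : exists g h l v,
    [/\ ideal_exp O B m g, ideal_exp O B m h, ideal_exp O B m l &
     [/\ O v, ~ q v & om * (g * h * l) = alpha * v]].
  (* If every such [v] were in [q], then om B^b, and with it s alpha, would lie in alpha q;
     cancelling alpha would put [s] in [q]. *)
  apply: NNPP => no; apply: nqs.
  have omB x : ideal_exp O B b x -> exists2 v, q v & om * x = alpha * v.
    rewrite Db => Bx.
    suff [] : O x /\ exists2 v, q v & om * x = alpha * v by [].
    apply: (ideal_exp_add_min HO HB (Kq _ Oom)) Bx => y l By Bl; have Ol := BO _ Bl.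
    suff [] : O y /\ (O (y * l) /\ exists2 v, q v & om * (y * l) = alpha * v) by [].
    apply: (ideal_exp_add_min HO HB (ideal_colon HO (Kq _ Oom) Ol)) By => g h Bg Bh.
    have Og := BO _ Bg; have Oh := BO _ Bh; do 2!(split; first by mem HO).
    have [r Or Er] := prod3 _ _ _ Bg Bh Bl; exists r => //.
    by apply: NNPP => nqr; apply: no; exists g, h, l, r.
  have [_ [v qv /eqP]] : O alpha /\ exists2 v, q v & s * alpha = alpha * v.
    have al : pideal O alpha alpha by apply/(pidealP HO) => //; exists 1; [mem HO | rewrite mulr1].
    move/Eal: al; apply: (ideal_mul_min (Kq _ Os)) => p x Pp Bx.
    have [BbO _ _ _] := ideal_exp_ideal HO b HB.
    have Op := PaO _ Pp; have Ox := BbO _ Bx; split; first by mem HO.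
    have [r Or Er] := Ps _ Pp; have [v qv Ev] := omB _ Bx.
    exists (r * v); first exact: (primeMr Hq).
    by rewrite mulrA Er mulrAC Ev mulrAC mulrA.
  by rewrite mulrC (inj_eq (mulfI nz_al)) => /eqP ->.
have [Og Oh Ol] := And3 (BO _ Bg) (BO _ Bh) (BO _ Bl).
have [w1 Ow1 E1] := prod3 _ _ _ Bg Bg Bg; have [w2 Ow2 E2] := prod3 _ _ _ Bh Bh Bh.
have [w3 Ow3 E3] := prod3 _ _ _ Bl Bl Bl.
exists g, w1; split=> //; last by rewrite -E1; ring.
move=> qw1; apply: nqv; apply: (primeX HO Hq (n := 3)) => //.
(* The cube of om g h l is the product of om g^3, om h^3 and om l^3, so [w1] in [q] would force [v]
   in [q]. *)
have -> : v ^+ 3 = w1 * w2 * w3.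
  apply: (mulfI (expf_neq0 3 nz_al)).
  transitivity ((alpha * w1) * (alpha * w2) * (alpha * w3)); last by ring.
  by rewrite -exprMn -Ev -E1 -E2 -E3; ring.
by do 2!apply: (primeMl Hq) => //.
Qed.

Lemma prime_restrict (O O' Q : algC -> Prop) : is_subring O -> (forall x, O x -> O' x) ->
  is_prime_ideal O' Q -> is_prime_ideal O (fun x => Q x /\ O x).
Proof.
move=> HO OO' HQ; split; last 1 first.
- move=> x y Ox Oy [Qxy _].
  by case: (prime_mulP HQ (OO' _ Ox) (OO' _ Oy) Qxy); [left | right].
- split=> [x []||x y [Qx Ox] [Qy Oy]|r x Or [Qx Ox]] //.
  + by split; [exact: (prime0 HQ) | mem HO].
  + by split; [exact: (primeD HQ) | mem HO].
  + by split; [exact: (primeMr HQ (OO' _ Or)) | mem HO].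
- by case=> /(prime1 HQ).
Qed.

Lemma prime_preim (O Q : algC -> Prop) (f : {rmorphism algC -> algC}) :
  is_subring O -> (forall x, O x -> O (f x)) ->
  is_prime_ideal O Q -> is_prime_ideal O (fun x => O x /\ Q (f x)).
Proof.
move=> HO Of HQ; split; last 1 first.
- move=> x y Ox Oy [_]; rewrite rmorphM => Qxy.
  by case: (prime_mulP HQ (Of _ Ox) (Of _ Oy) Qxy); [left | right].
- split=> [x []||x y [Ox Qx] [Oy Qy]|r x Or [Ox Qx]] //.
  + by rewrite rmorph0; split; [mem HO | exact: (prime0 HQ)].
  + by rewrite rmorphD; split; [mem HO | exact: (primeD HQ)].
  + by rewrite rmorphM; split; [mem HO | exact: (primeMr HQ (Of _ Or))].
- by case=> _; rewrite rmorph1 => /(prime1 HQ).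
Qed.

(** An [x] outside (p) would be invertible modulo p, hence modulo [Q], which contains p. *)
Lemma Ok_prime_max p (O Q : algC -> Prop) : Ok p -> p != 0 ->
    is_prime_ideal Ok (pideal Ok p) -> (forall x, Ok x -> O x) -> is_subring O ->
    is_prime_ideal O Q -> Q p ->
  forall x, Ok x -> Q x -> pideal Ok p x.
Proof.
move=> Op nz_p Hp OkO HO HQ Qp x Ox Qx; apply: NNPP => npx; have HOk := Ok_subring.
have pp : pideal Ok p p by apply/(pidealP HOk) => //; exists 1; [mem HOk | rewrite mulr1].
have [|v Ov] := prime_inverse (genfield_subfield _) Hp _ Ox npx; first by exists p.
case/(pidealP HOk _ Op) => r Or E; apply: (prime1 HQ).
have -> : 1 = x * v - p * r by rewrite -E; ring.
apply: (primeB HO HQ); first exact: (primeMl HQ (OkO _ Ov)).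
exact: (primeMl HQ (OkO _ Or)).
Qed.

(* [Q] is contained in the ideal generated by [u] in the localization of O_F at [Q]. *)
Definition locally_in (Q F : algC -> Prop) (u : algC) : Prop :=
  exists2 d, ints F d /\ ~ Q d &
    forall x, ints F x -> Q x -> exists2 r, ints F r & d * x = u * r.

(** * Passing local principality up a cubic step *)

Section Local.
Variables (R Q : algC -> Prop).
Hypotheses (HR : is_subfield R) (HQ : is_prime_ideal (ints R) Q) (Rz : R zeta3).
Let HO : is_subring (ints R) := ints_subring HR.

Lemma ints_zeta3 F : F zeta3 -> ints F zeta3.
Proof. by move=> Fz; split=> //; exact: zeta3_Aint. Qed.

Lemma not_subr1_zeta3 : ~ Q 3 -> ~ Q (1 - zeta3).
Proof.
have Oz := ints_zeta3 Rz; move=> n3 Qz; apply: n3.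
have -> : 3 = - ((1 - zeta3) * (1 - zeta3) * zeta3 ^+ 2) :> algC.
  rewrite -expr2 subr1_zeta3_sqr -[LHS]mulr1 -zeta3_cube; ring.
apply: (primeN HO HQ); apply: (primeMl HQ); first by mem HO.
by apply: (primeMl HQ) => //; mem HO.
Qed.

(** The relation s v = zeta3 v makes both differences comparable: -zeta3 (y - s^2 y) = (1 - zeta3) v
    = y - s y. Two choices of [v] occur later: b / (1 - zeta3), which may fail to be integral, and y
    itself. *)
Lemma kummer_unramified_step (F F' : algC -> Prop) (b u y v : algC)
    (s : {rmorphism algC -> algC}) :
    is_subfield F -> is_subfield F' -> F zeta3 ->
    (forall x, F x -> F' x) -> (forall x, F' x -> R x) ->
    (forall x, F x -> s x = x) -> s b = zeta3 * b -> (forall x, F' x -> F' (s x)) ->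
    (forall x, F' x -> kummer_span F b x) ->
    ints F' u -> ints F' y -> y - s y = (1 - zeta3) * v -> s v = zeta3 * v ->
    ~ Q ((1 - zeta3) * v) ->
  locally_in Q F u -> locally_in Q F' u.
Proof.
move=> HF HF' Fz FF' F'R sF sb sF' F'b Ou Oy Dv sv nQv [c [Oc nQc] Qc].
have HO' := ints_subring HF'.
have sub x : ints F' x -> ints R x by case=> F'x Ax; split=> //; apply: F'R.
have sub' x : ints F x -> ints F' x by case=> Fx Ax; split=> //; apply: FF'.
have sO x : ints F' x -> ints F' (s x).
  by case=> F'x Ax; split; [exact: sF' | rewrite Aint_aut].
have HQ' := prime_restrict HO' sub HQ.
have Oz : ints F' zeta3 by exact: sub' (ints_zeta3 Fz).
have sz : s zeta3 = zeta3 by exact: sF.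
have D2 : - zeta3 * (y - s (s y)) = (1 - zeta3) * v.
  have -> : y - s (s y) = (y - s y) + s (y - s y) by rewrite rmorphB; ring.
  rewrite Dv rmorphM rmorphB rmorph1 sz sv.
  transitivity ((1 - zeta3 ^+ 3 + zeta3 ^+ 3 - zeta3 + (zeta3 ^+ 3 - 1)) * v); first by ring.
  by rewrite zeta3_cube; ring.
have [d [Od nQd] dQ] : exists2 d, ints F' d /\ ~ (Q d /\ ints F' d) &
    forall x, Q x /\ ints F' x -> exists2 r, ints F' r & d * x = u * r.
  apply: (@unramified_step _ _ HO' HQ' (ints F) s y c u) => //.
  - by move=> x [F'x _]; apply: (kummer_order3 Fz sF sb (F'b _ F'x)).
  - move=> x [F'x Ax]; split; first exact: (kummer_traceF HF Fz sF sb (F'b _ F'x)).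
    by rewrite rpredD ?rpredD ?Aint_aut.
  - by rewrite Dv; case.
  - case=> Qy _; apply: nQv; rewrite -D2; apply: (primeMr HQ) => //.
    by apply: sub; mem HO'.
  - exact: sub'.
  - by case.
  move=> x Ox [Qx _]; have [r Or E] := Qc _ Ox Qx.
  by exists r => //; apply: sub'.
by exists d => [|x Ox Qx]; [split=> // Qd; apply: nQd | apply: dQ].
Qed.

Lemma locally_in_ram_index u e : ints R u -> Q u -> u != 0 -> locally_in Q R u ->
  ~ ideal_exp (ints R) Q e.+1 (u ^+ e).
Proof.
move=> Ou Qu nz_u [d [Od nQd] dQ].
apply: (prime_colon_exp_not HO HQ Od Ou nQd Qu nz_u) => x Qx.
by apply: dQ => //; apply: (prime_sub HQ).
Qed.

(** Traces twisted by powers of [zeta3] show that 3 c0 and 3 c1 b, hence also 3 c2 b^2, are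
    integral, and [Ok_prime_cube] removes the powers of b. For x in Q, 3 c0 lies in Q, hence is
    divisible by p = b^3, so b divides 3 x, with 3 outside Q. *)
Lemma tame_locally_in (p b : algC) (F' : algC -> Prop) (s : {rmorphism algC -> algC}) :
    Ok p -> p != 0 -> is_prime_ideal Ok (pideal Ok p) -> b ^+ 3 = p ->
    is_subfield F' -> (forall x, kk x -> F' x) -> F' b ->
    (forall x, F' x -> R x) ->
    (forall x, kk x -> s x = x) -> s b = zeta3 * b -> (forall x, F' x -> F' (s x)) ->
    (forall x, F' x -> kummer_span kk b x) ->
    Q p -> ~ Q 3 ->
  locally_in Q F' b.
Proof.
move=> Op nz_p Hp Db HF' kF' F'b F'R sk sb sF' F'k Qp nQ3.
have HO' := ints_subring HF'; have HOk := Ok_subring; have Hk := kk_subring.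
have HFk := genfield_subfield [:: zeta3].
have sub x : ints F' x -> ints R x by case=> F'x Ax; split=> //; apply: F'R.
have sub' x : Ok x -> ints F' x by case=> Fx Ax; split=> //; apply: kF'.
have Ab : b \in Aint by apply: Aint_cube; rewrite Db; case: Op.
have nz_b : b != 0 by apply: contra_neq nz_p => b0; rewrite -Db b0 expr0n.
exists 3; first by split=> //; mem HO'.
move=> x [F'x Ax] Qx; have [c0 [c1 [c2 [k0 k1 k2 Dx]]]] := F'k _ F'x.
have sz := sk _ kk_zeta3; have Az := zeta3_Aint.
have As y : y \in Aint -> s y \in Aint by rewrite Aint_aut.
have sx : s x = c0 + zeta3 * (c1 * b) + zeta3 ^+ 2 * (c2 * b ^+ 2).
  rewrite Dx !rmorphD (rmorphM s c1) (rmorphM s c2) rmorphXn.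
  by rewrite (sk _ k0) (sk _ k1) (sk _ k2) sb; ring.
have ssx : s (s x) = c0 + zeta3 ^+ 2 * (c1 * b) + zeta3 ^+ 4 * (c2 * b ^+ 2).
  rewrite sx !rmorphD (rmorphM s zeta3) sz (rmorphM s (zeta3 ^+ 2)) rmorphXn sz.
  rewrite (rmorphM s c1) (rmorphM s c2) rmorphXn (sk _ k0) (sk _ k1) (sk _ k2) sb; ring.
have A0 : 3 * c0 \in Aint.
  rewrite -(kummer_trace kk_zeta3 sk sb k0 k1 k2 Dx); by rewrite !rpredD ?As.
have z4 : zeta3 ^+ 4 = zeta3 by rewrite exprS zeta3_cube mulr1.
have A1 : 3 * c1 * b \in Aint.
  have -> : 3 * c1 * b = x + zeta3 ^+ 2 * s x + zeta3 * s (s x).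
    rewrite ssx sx Dx.
    transitivity ((1 + zeta3 + zeta3 ^+ 2) * c0 + (1 + 2 * zeta3 ^+ 3) * (c1 * b)
       + (1 + zeta3 ^+ 4 + zeta3 ^+ 4 * zeta3) * (c2 * b ^+ 2)); last by ring.
    by rewrite z4 zeta3_cube -expr2 zeta3_sqr; ring.
  have [As1 As2] := (As _ Ax, As _ (As _ Ax)); apply: rpredD; last exact: rpredM.
  by apply: rpredD => //; apply: rpredM => //; apply: rpredX.
have A2 : 3 * c2 * b ^+ 2 \in Aint.
  have -> : 3 * c2 * b ^+ 2 = 3 * x - 3 * c0 - 3 * c1 * b by rewrite Dx; ring.
  by rewrite !rpredB // rpredM // rpred_nat.
have O0 : Ok (3 * c0) by split=> //; mem Hk.
have O1 : Ok (3 * c1).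
  apply: (@Ok_prime_cube p Op nz_p Hp _ 1) => //; first by mem Hk.
  by rewrite expr1 -Db -exprMn rpredX.
have O2 : Ok (3 * c2).
  apply: (@Ok_prime_cube p Op nz_p Hp _ 2) => //; first by mem Hk.
  by rewrite -Db -exprM mulnC exprM -exprMn rpredX.
have Ob : ints F' b by [].
have [Oc0 Oc1 Oc2] := And3 (sub' _ O0) (sub' _ O1) (sub' _ O2).
have Qb : Q b by apply: (primeX HO HQ (n := 3)); rewrite ?Db //; apply: sub.
have : Q (3 * c0).
  have -> : 3 * c0 = 3 * x - b * (3 * c1 + 3 * c2 * b) by rewrite Dx; ring.
  apply: (primeB HO HQ); first by apply: (primeMr HQ) => //; mem HO.
  by apply: (primeMl HQ) => //; apply: sub; mem HO'.
have OkR y : Ok y -> ints R y by move=> Oy; apply/sub/sub'.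
move/(Ok_prime_max Op nz_p Hp OkR HO HQ Qp O0).
case/(pidealP HOk _ Op) => e Oe E0; have Oe' := sub' _ Oe.
exists (b ^+ 2 * e + 3 * c1 + 3 * c2 * b); first by mem HO'.
transitivity (3 * c0 + 3 * c1 * b + 3 * c2 * b ^+ 2); first by rewrite Dx; ring.
by rewrite E0 -Db; ring.
Qed.

End Local.

(** With y the quotient, dividing ((1 - zeta3) y + eta)^3 = eta^3 + (1 - zeta3)^3 g by (1 - zeta3)^3
    leaves a monic cubic in y with integral coefficients, because 3 = -(1 - zeta3)^2 zeta3^2. *)
Lemma kummer_integral b eta g : eta \in Aint -> g \in Aint ->
  b ^+ 3 = eta ^+ 3 + (1 - zeta3) ^+ 3 * g -> (b - eta) / (1 - zeta3) \in Aint.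
Proof.
move=> Ae Ag Db; have Az := zeta3_Aint; have nz : 1 - zeta3 != 0.
  by rewrite -oppr_eq0 opprB zeta3_neq1.
have D3 : 3 = - (1 - zeta3) ^+ 2 * zeta3 ^+ 2.
  rewrite subr1_zeta3_sqr -[LHS]mulr1 -zeta3_cube; ring.
set y := _ / _; have Dy : b = (1 - zeta3) * y + eta by rewrite /y mulrC divfK // subrK.
apply: (@Aint_cubic y (- (1 - zeta3) * zeta3 ^+ 2 * eta) (- zeta3 ^+ 2 * eta ^+ 2) (- g)).
- apply: rpredM => //; apply: rpredM; last exact: rpredX.
  by rewrite rpredN; apply: rpredB => //; apply: Aint1.
- by apply: rpredM; [rewrite rpredN; apply: rpredX | apply: rpredX].
- by rewrite rpredN.
apply: (mulfI (expf_neq0 3 nz)); rewrite mulr0.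
transitivity ((1 - zeta3) ^+ 3 * y ^+ 3 + (- (1 - zeta3) ^+ 2 * zeta3 ^+ 2) *
  ((1 - zeta3) ^+ 2 * y ^+ 2 * eta + (1 - zeta3) * y * eta ^+ 2) - (1 - zeta3) ^+ 3 * g).
  by ring.
have -> : (1 - zeta3) ^+ 3 * g = b ^+ 3 - eta ^+ 3 by rewrite Db; ring.
by rewrite -D3 Dy; ring.
Qed.

Lemma ideal_coprimeP (O B : algC -> Prop) (c : algC) : is_subring O -> is_ideal O B -> O c ->
  ideal_coprime O B (pideal O c) -> exists2 b, B b & exists2 r, O r & 1 = b + c * r.
Proof.
move=> HO HB Oc; case: (HB) => BO B0 BD BM.
pose I x := O x /\ exists2 b, B b & exists2 r, O r & x = b + c * r.
suff HI : is_ideal O I.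
  move=> /(_ I HI)[|//]; move=> x [Bx | /(pidealP HO _ Oc)[r Or ->]].
    by split; [exact: BO | exists x => //; exists 0; [mem HO | rewrite mulr0 addr0]].
  by split; [mem HO | exists 0 => //; exists r; rewrite ?add0r].
split=> [x []||x y [Ox [b Bb [r Or Ex]]] [Oy [b' Bb' [r' Or' Ey]]]
  |k x Ok [Ox [b Bb [r Or Ex]]]] //.
- by split; [mem HO | exists 0 => //; exists 0; [mem HO | rewrite mulr0 addr0]].
- split; first by mem HO.
  exists (b + b'); [exact: BD | exists (r + r'); [mem HO | rewrite Ex Ey; ring]].
- split; first by mem HO.
  exists (k * b); [exact: BM | exists (k * r); [mem HO | rewrite Ex; ring]].
Qed.

(* [b] is congruent to [eta] modulo the prime [1 - zeta3], so
   y = (b - eta) / (1 - zeta3) is integral and y - s y = b. *)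
Lemma kummer_congruence_step (R Q F F' : algC -> Prop) (b u eta g : algC)
    (s : {rmorphism algC -> algC}) :
    is_prime_ideal (ints R) Q ->
    is_subfield F -> is_subfield F' -> F zeta3 ->
    (forall x, F x -> F' x) -> (forall x, F' x -> R x) ->
    (forall x, F x -> s x = x) -> s b = zeta3 * b -> (forall x, F' x -> F' (s x)) ->
    (forall x, F' x -> kummer_span F b x) ->
    ints F' u -> F' b -> ~ Q b -> ints F eta -> g \in Aint ->
    b ^+ 3 = eta ^+ 3 + (1 - zeta3) ^+ 3 * g ->
  locally_in Q F u -> locally_in Q F' u.
Proof.
move=> HQ HF HF' Fz FF' F'R sF sb sF' F'b Ou F'b' nQb [Feta Aeta] Ag Db.
have nz : 1 - zeta3 != 0 by rewrite -oppr_eq0 opprB zeta3_neq1.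
have HO' := subfield_subring HF'; have F'z := FF' _ Fz; have F'e := FF' _ Feta.
have F'V : F' (1 - zeta3)^-1 by apply: (subfieldV HF'); mem HO'.
have sz := sF _ Fz.
have sV : s (1 - zeta3)^-1 = (1 - zeta3)^-1 by rewrite fmorphV rmorphB rmorph1 sz.
apply: (@kummer_unramified_step R Q HQ F F' b u
   ((b - eta) / (1 - zeta3)) (b / (1 - zeta3)) s) => //.
- by split; [mem HO' | apply: kummer_integral Db].
- by rewrite rmorphM sV rmorphB sb (sF _ Feta); field.
- by rewrite rmorphM sV sb mulrA.
- by rewrite mulrC divfK.
Qed.

(** * The tower and its Galois group *)

Section Tower.
Variables (pi1 pi2 a1 a2 : algC) (tau : {rmorphism algC -> algC}).
Hypotheses (Hpi1 : Ok pi1) (Hpi2 : Ok pi2).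
Hypotheses (nz1 : pi1 != 0) (nz2 : pi2 != 0).
Hypothesis pi2_prime : is_prime_ideal Ok (pideal Ok pi2).
Hypothesis ndvd : ~ pideal Ok pi2 pi1.
Hypotheses (Ha1 : a1 ^+ 3 = pi1) (Ha2 : a2 ^+ 3 = pi2).
Hypotheses (Htau_k : forall x, kk x -> tau x = x) (Htau_a1 : tau a1 = zeta3 * a1).

Notation K1 := (genfield [:: zeta3; a1]).
Notation K2 := (genfield [:: zeta3; a1; a2]).

Let H1 : is_subring K1 := genfield_subring _.
Let H2 : is_subring K2 := genfield_subring _.

Lemma K1_zeta3 : K1 zeta3. Proof. by apply: genfield_mem; rewrite inE eqxx. Qed.
Lemma K1_a1 : K1 a1. Proof. by apply: genfield_mem; rewrite !inE eqxx orbT. Qed.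
Lemma K2_a2 : K2 a2. Proof. by apply: genfield_mem; rewrite !inE eqxx !orbT. Qed.
Lemma kk_K1 x : kk x -> K1 x. Proof. by apply: kk_genfield; rewrite inE eqxx. Qed.
Lemma K1_K2 x : K1 x -> K2 x.
Proof. by apply: genfield_sub => y; rewrite !inE => /orP[] ->; rewrite ?orbT. Qed.

Lemma a1_neq0 : a1 != 0. Proof. by apply: contra_neq nz1 => a0; rewrite -Ha1 a0 expr0n. Qed.
Lemma a2_neq0 : a2 != 0. Proof. by apply: contra_neq nz2 => a0; rewrite -Ha2 a0 expr0n. Qed.

Lemma K1_kummer x : K1 x -> kummer_span kk a1 x.
Proof.
move: x; apply: (@kummer_genfield kk a1 tau _ _ _ Htau_k Htau_a1) => [||| y];
  [exact: genfield_subfield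
  | exact: kk_zeta3 | by rewrite Ha1; case: Hpi1 |].
by rewrite !inE => /orP[] /eqP ->; [left; apply: kk_zeta3 | right].
Qed.

Lemma tau3 x : K1 x -> tau (tau (tau x)) = x.
Proof. by move/K1_kummer; apply: (kummer_order3 kk_zeta3 Htau_k Htau_a1). Qed.

Lemma tau_K1 x : K1 x -> K1 (tau x).
Proof.
move: x; apply: (rmorph_genfield (genfield_subfield _)) => s; rewrite !inE => /orP[] /eqP ->.
  by rewrite (Htau_k kk_zeta3); apply: K1_zeta3.
by rewrite Htau_a1; have := K1_zeta3; have := K1_a1 => *; mem H1.
Qed.

Lemma tau_fixed x : K1 x -> tau x = x -> kk x.
Proof.
move=> Kx; exact: (kummer_fixed (genfield_subfield _) kk_zeta3 Htau_k Htau_a1 (K1_kummer Kx)).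
Qed.

(** Kummer theory by hand: [tau] multiplies [x] by zeta3^i, so d = x / a1^i lies in k and (d pi1)^3
    = pi2 pi1^(3-i). Then pi2 divides d pi1, so pi2^3 divides the right-hand side and pi2 divides
    pi1^(3-i), against [ndvd]. *)
Lemma pi2_not_cube x : K1 x -> x ^+ 3 <> pi2.
Proof.
move=> Kx Dx; have HO := Ok_subring.
have [i i3 tx] : exists2 i, (i < 3)%N & tau x = zeta3 ^+ i * x.
  by apply: cube_root_image; rewrite Dx; apply: Htau_k; case: Hpi2.
have nz_a1 := a1_neq0.
pose d := x / a1 ^+ i.
have kd : kk d.
  apply: tau_fixed.
    have := subfieldV (genfield_subfield _) K1_a1; rewrite /d -exprVn => *; mem H1.
  rewrite /d rmorphM fmorphV rmorphXn tx Htau_a1 [(zeta3 * a1) ^+ i]exprMn.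
  rewrite invfM mulrACA mulfV ?mul1r //.
  by rewrite expf_neq0 // zeta3_neq0.
have Df : (d * pi1) ^+ 3 = pi2 * pi1 ^+ (3 - i).
  rewrite /d !exprMn exprVn Dx -exprM mulnC exprM Ha1 -mulrA; congr (_ * _).
  rewrite mulrC; apply: (mulIf (expf_neq0 i nz1)).
  by rewrite mulfVK ?expf_neq0 // -exprD subnK // ltnW.
have [kp1 Ap1] := Hpi1.
have : pideal Ok pi2 (d * pi1).
  apply: Ok_prime_cube_dvd Df => //; last exact: rpredX.
  by have HR := kk_subring; mem HR.
case/(pidealP HO _ Hpi2) => g Og Dg; apply: ndvd.
apply: (primeX HO pi2_prime (n := 3 - i)) => //; apply/(pidealP HO) => //.
exists (pi2 * g ^+ 3); first by mem HO.
by apply: (mulfI nz2); rewrite -Df Dg; ring.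
Qed.

Lemma a2_notin_K1 : ~ K1 a2.
Proof. by move/pi2_not_cube. Qed.

(** * The field R and its generating automorphisms *)

Section Theta.
Variables (theta alpha beta t : algC) (c : nat).
Hypotheses (Dtheta : theta = zeta3 ^+ c * alpha ^+ 2 * tau alpha).
Hypotheses (Kalpha : K1 alpha) (kbeta : kk beta) (nz_alpha : alpha != 0).
Hypothesis Nalpha : alpha * tau alpha * tau (tau alpha) = pi2 * beta ^+ 3.
Hypothesis Ht : t ^+ 3 = theta.

Notation R := (genfield [:: zeta3; a1; a2; t]).
Variable u : algC.
Hypothesis Du : u = a2 * beta / alpha.

Lemma beta_neq0 : beta != 0.
Proof.
have : pi2 * beta ^+ 3 != 0 by rewrite -Nalpha !mulf_neq0 ?fmorph_eq0.
by apply: contra_neq => ->; rewrite expr0n mulr0.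
Qed.

Lemma K1_theta : K1 theta.
Proof.
have := K1_zeta3; have := tau_K1 Kalpha; rewrite Dtheta => *; mem H1.
Qed.

Lemma theta_neq0 : theta != 0.
Proof.
by rewrite Dtheta !mulf_neq0 ?expf_neq0 ?fmorph_eq0 ?zeta3_neq0.
Qed.

Lemma t_neq0 : t != 0.
Proof. by apply: contra_neq theta_neq0 => t0; rewrite -Ht t0 expr0n. Qed.

Lemma u_cube : u ^+ 3 = tau theta / theta.
Proof.
have nz_ta : tau alpha != 0 by rewrite fmorph_eq0.
have nz_z := expf_neq0 c zeta3_neq0.
rewrite Du !exprMn Ha2 exprVn -Nalpha Dtheta.
rewrite 2!rmorphM (rmorphXn tau 2 alpha) (_ : tau (zeta3 ^+ c) = zeta3 ^+ c).
  by field; rewrite nz_alpha nz_ta nz_z.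
by apply: Htau_k; have := kk_zeta3; have HR := kk_subring => *; mem HR.
Qed.

Lemma u_not_cube g : K1 g -> g ^+ 3 <> u ^+ 3.
Proof.
move=> Kg Dg; have nz_b := beta_neq0; apply: (@pi2_not_cube (g * alpha / beta)).
  have := subfieldV (genfield_subfield _) (kk_K1 kbeta) => *; mem H1.
rewrite !exprMn exprVn Dg Du -Ha2; field.
by rewrite nz_alpha nz_b.
Qed.

Lemma K2_kummer (f : {rmorphism algC -> algC}) x : (forall y, K1 y -> f y = y) ->
  f a2 = zeta3 * a2 -> K2 x -> kummer_span K1 a2 x.
Proof.
move=> fK fa2; apply: (@kummer_genfield K1 a2 f _ _ _ fK fa2) => [||| y].
- exact: genfield_subfield.
- exact: K1_zeta3.
- by rewrite Ha2; apply: kk_K1; case: Hpi2.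
rewrite !inE => /or3P[] /eqP ->; [left; exact: K1_zeta3 | left; exact: K1_a1 | by right].
Qed.

Lemma K1_aut j : exists2 f : {rmorphism algC -> algC},
  (forall x, K1 x -> f x = x) & f a2 = zeta3 ^+ j * a2.
Proof.
apply: kummer_aut a2_notin_K1; first exact: K1_zeta3.
by rewrite Ha2; apply: kk_K1; case: Hpi2.
Qed.

(** If [t] were in K2, Kummer theory over K1 would give theta = pi2^i g^3 with g in K1. As [tau]
    fixes pi2, u^3 = tau theta / theta would be the cube of tau g / g. *)
Lemma t_notin_K2 : ~ K2 t.
Proof.
move=> Kt; have [f fK fa2] := K1_aut 1.
have [i i3 ft] : exists2 i, (i < 3)%N & f t = zeta3 ^+ i * t.
  by apply: cube_root_image; rewrite Ht; apply: (fK _ K1_theta).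
have nz_a2i := expf_neq0 i a2_neq0.
pose g := t / a2 ^+ i.
have Kg : K1 g.
  apply: (kummer_fixed (genfield_subfield _) K1_zeta3 fK fa2 (K2_kummer fK fa2 _)).
    have := subfieldV (genfield_subfield _) K2_a2; rewrite /g -exprVn => *; mem H2.
  rewrite /g rmorphM fmorphV rmorphXn ft fa2 expr1 [(zeta3 * a2) ^+ i]exprMn invfM mulrACA.
  by rewrite mulfV ?mul1r // expf_neq0 // zeta3_neq0.
have Dt : theta = pi2 ^+ i * g ^+ 3.
  rewrite -Ht /g !exprMn exprVn -Ha2 -!exprM mulnC [(i * 3)%N]mulnC mulrC.
  by rewrite mulfVK // expf_neq0 // a2_neq0.
have nz_g : g != 0.
  by apply: contra_neq theta_neq0 => g0; rewrite Dt g0 expr0n mulr0.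
clearbody g; apply: (@u_not_cube (tau g / g)).
  have := subfieldV (genfield_subfield _) Kg; have := tau_K1 Kg => *; mem H1.
have tp2 : tau pi2 = pi2 by apply: Htau_k; case: Hpi2.
rewrite u_cube Dt rmorphM !rmorphXn tp2 exprMn exprVn.
by field; rewrite nz_g expf_neq0.
Qed.

Lemma K2_R x : K2 x -> R x.
Proof.
by apply: genfield_sub => y; rewrite !inE => /or3P[] ->; rewrite ?orbT.
Qed.

Lemma K1_R x : K1 x -> R x. Proof. by move=> Kx; exact: K2_R (K1_K2 Kx). Qed.

Lemma R_t : R t. Proof. by apply: genfield_mem; rewrite !inE eqxx !orbT. Qed.

(* y a2 = zeta3^2 a2, rather than zeta3 a2, makes x y = y x z (see [heis_comm]), so that
   z^n y^m x^k corresponds to the unitriangular matrix with entries k, m above the diagonal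
   and n in the corner. *)
Record heis_gen (x y z : {rmorphism algC -> algC}) : Prop := HeisGen {
  heis_x_k : forall w, kk w -> x w = w;
  heis_x1 : x a1 = zeta3 * a1;
  heis_x2 : x a2 = a2;
  heis_xt : x t = t * u;
  heis_y_K1 : forall w, K1 w -> y w = w;
  heis_y2 : y a2 = zeta3 ^+ 2 * a2;
  heis_yt : y t = t;
  heis_z_K2 : forall w, K2 w -> z w = w;
  heis_zt : z t = zeta3 * t }.

Lemma heis_gen_exists : exists x y z, heis_gen x y z.
Proof.
have Kth := K1_theta.
have [z zK zt] : exists2 f : {rmorphism algC -> algC},
    (forall x, K2 x -> f x = x) & f t = zeta3 ^+ 1 * t.
  apply: kummer_aut t_notin_K2; first exact: K1_K2 K1_zeta3.
  by rewrite Ht; apply: K1_K2.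
rewrite expr1 in zt; have zz : z zeta3 = zeta3 by exact: zK (K1_K2 K1_zeta3).
have zpt n b : rmorph_iter z n (zeta3 ^+ b * t) = zeta3 ^+ (b + n) * t.
  rewrite rmorphM rmorphXn (rmorph_iter_fix _ zz).
  by rewrite (rmorph_iter_root (j := 1) _ zz) // mulrA -exprD mul1n.
have zpK n w : K2 w -> rmorph_iter z n w = w by move/zK/rmorph_iter_fix.
have z3 n : zeta3 ^+ (3 * n) = 1 by rewrite exprM zeta3_cube expr1n.
have [y0 y0K y02] := K1_aut 2.
have [i i3 y0t] : exists2 i, (i < 3)%N & y0 t = zeta3 ^+ i * t.
  by apply: cube_root_image; rewrite Ht; apply: y0K.
(* The exponent 2 i is minus i modulo 3: it undoes what [y0] does to [t]. *)
pose y : {rmorphism algC -> algC} := rmorph_iter z (2 * i) \o y0.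
have yK w : K1 w -> y w = w by move=> Kw; rewrite /= y0K // zpK //; apply: K1_K2.
have yt : y t = t by rewrite /= y0t zpt -mulSn z3 mul1r.
have y2 : y a2 = zeta3 ^+ 2 * a2.
  rewrite /= y02 zpK //; have := K2_a2; have := K1_K2 K1_zeta3 => *; mem H2.
have yz := yK _ K1_zeta3.
(* [tau] is prescribed only on K1. Its effect on a2 is undone by y^j, as y multiplies a2 by zeta3^2;
   y^j also multiplies u by zeta3^(2j), whence the exponent m + 2 j left for z to cancel on t. *)
have [j j3 tau2] : exists2 j, (j < 3)%N & tau a2 = zeta3 ^+ j * a2.
  by apply: cube_root_image; rewrite Ha2; apply: Htau_k; case: Hpi2.
have [m m3 taut] : exists2 m, (m < 3)%N & tau t = zeta3 ^+ m * (t * u).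
  apply: eq_cube; rewrite -rmorphXn Ht exprMn Ht u_cube mulrC mulfVK //.
  exact: theta_neq0.
pose x1 : {rmorphism algC -> algC} := rmorph_iter y j \o tau.
have x12 : x1 a2 = a2.
  rewrite /= tau2 rmorphM rmorphXn (rmorph_iter_fix _ yz).
  by rewrite (rmorph_iter_root _ yz y2) mulrA -exprD -mulSn z3 mul1r.
have x1t : x1 t = zeta3 ^+ (m + 2 * j) * (t * u).
  rewrite /= taut Du !(rmorphM, fmorphV) rmorphXn (rmorph_iter_fix _ yz) (rmorph_iter_fix _ yt).
  rewrite (rmorph_iter_root _ yz y2) (rmorph_iter_fix _ (yK _ (kk_K1 kbeta))).
  by rewrite (rmorph_iter_fix _ (yK _ Kalpha)) exprD; ring.
pose x : {rmorphism algC -> algC} := rmorph_iter z (2 * (m + 2 * j)) \o x1.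
have xE w : x w = rmorph_iter z (2 * (m + 2 * j)) (x1 w) by [].
exists x, y, z; split=> //.
- move=> w kw; rewrite /= (Htau_k kw) (rmorph_iter_fix _ (yK _ (kk_K1 kw))).
  exact: zpK (K1_K2 (kk_K1 kw)).
- rewrite /= Htau_a1; have Kza : K1 (zeta3 * a1).
    by have := K1_zeta3; have := K1_a1 => *; mem H1.
  by rewrite (rmorph_iter_fix _ (yK _ Kza)) zpK //; apply: K1_K2.
- by rewrite xE x12; apply: zpK; exact: K2_a2.
- rewrite xE x1t mulrA rmorphM zpt -mulSn z3 mul1r zpK //.
  rewrite Du; have := K2_a2; have := K1_K2 (kk_K1 kbeta).
  have := subfieldV (genfield_subfield _) (K1_K2 Kalpha) => *; mem H2.
Qed.

(** To recover a1: an automorphism fixing the right-hand field and moving a1 acts on K1 as tau or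
    tau^2, so tau theta = theta and u^3 = 1 would be a cube in K1. Then all of K1 is there, and a2
    comes from t2 / t, which is u up to a root of unity. *)
Lemma R_conjugates t2 t3 : t2 ^+ 3 = tau theta -> t3 ^+ 3 = tau (tau theta) ->
  forall w, R w <-> genfield [:: zeta3; t; t2; t3] w.
Proof.
move=> Ht2 Ht3 w; set K' := genfield [:: zeta3; t; t2; t3].
have [x [y [z G]]] := heis_gen_exists.
have HR := genfield_subfield [:: zeta3; a1; a2; t].
have HR' := subfield_subring HR.
have HK : is_subfield K' := genfield_subfield _; have HK' := subfield_subring HK.
have [nz_t nz_th nz_b] := And3 t_neq0 theta_neq0 beta_neq0.
have Rz : R zeta3 by exact: (K1_R K1_zeta3).
have Ra2 := K2_R K2_a2; have Rt := R_t; have Rb := K1_R (kk_K1 kbeta).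
have [i i3 Dt2] : exists2 i, (i < 3)%N & t2 = zeta3 ^+ i * (t * u).
  by apply: eq_cube; rewrite Ht2 exprMn Ht u_cube mulrC mulfVK.
have Kz : K' zeta3 by apply: genfield_mem; rewrite !inE eqxx.
have Kt : K' t by apply: genfield_mem; rewrite !inE eqxx !orbT.
have Kt2 : K' t2 by apply: genfield_mem; rewrite !inE eqxx !orbT.
split; apply: genfield_min => // {}w.
  have Kth : K' theta by rewrite -Ht; mem HK'.
  have Ka1 : K' a1.
    apply: NNPP => /genfield_moved[f /fix_genfield fK fa1].
    have fk : forall v, kk v -> f v = v by apply: fix_kk; apply: fK.
    have [j j3 Df] : exists2 j, (j < 3)%N & f a1 = zeta3 ^+ j * a1.
      by apply: cube_root_image; rewrite Ha1; apply: fk; case: Hpi1.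
    have fE : forall v, K1 v -> f v = rmorph_iter tau j v.
      apply: eq_genfield => v; rewrite !inE => /orP[] /eqP -> /=.
        by rewrite (fk _ kk_zeta3) (rmorph_iter_fix _ (Htau_k kk_zeta3)).
      by rewrite Df (rmorph_iter_root (j := 1) _ (Htau_k kk_zeta3) Htau_a1) mul1n.
    suff tth : tau theta = theta.
      apply: (@u_not_cube 1); first by mem H1.
      by rewrite u_cube tth expr1n mulfV.
    have := fE _ K1_theta; rewrite (fK _ Kth).
    case: j j3 Df {fE} => [|[|[|j]]] // _ Df; first by case: fa1; rewrite Df mul1r.
    by move=> /= /(congr1 tau); rewrite (tau3 K1_theta).
  have K1K : forall v, K1 v -> K' v.
    by apply: genfield_min => // v; rewrite !inE => /orP[] /eqP ->.
  rewrite !inE => /or4P[] /eqP -> //.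
  have nz_z : zeta3 ^+ i != 0 by rewrite expf_neq0 ?zeta3_neq0.
  have -> : a2 = t2 / (zeta3 ^+ i * t) * alpha / beta.
    by rewrite Dt2 Du; field; rewrite nz_b nz_t nz_alpha nz_z.
  have := K1K _ (kk_K1 kbeta); have := K1K _ Kalpha => KA KB.
  have : K' (zeta3 ^+ i * t) by mem HK'.
  by move/(subfieldV HK) => KV; have := subfieldV HK KB => KVb; mem HK'.
have Ru : R u by have := subfieldV HR (K1_R Kalpha); rewrite Du => *; mem HR'.
have nz_ta : tau alpha != 0 by rewrite fmorph_eq0.
rewrite !inE => /or4P[] /eqP -> //; first by rewrite Dt2; mem HR'.
(* tau^2 theta = theta u^3 tau(u^3), and a2 beta / tau alpha is a cube root of tau(u^3) that lies in
   R. *)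
have [j j3 ->] : exists2 j, (j < 3)%N & t3 = zeta3 ^+ j * (t * u * (a2 * beta / tau alpha)).
  apply: eq_cube; rewrite Ht3 2!exprMn Ht u_cube.
  have -> : (a2 * beta / tau alpha) ^+ 3 = tau (u ^+ 3).
    rewrite Du !exprMn !exprVn Ha2 (rmorphM tau (pi2 * beta ^+ 3)) (rmorphM tau pi2).
    by rewrite fmorphV 2!rmorphXn (Htau_k kbeta) (Htau_k (x := pi2)) //; case: Hpi2.
  rewrite u_cube rmorphM fmorphV; field.
  by rewrite fmorph_eq0 nz_th.
have := subfieldV HR (K1_R (tau_K1 Kalpha)) => *; mem HR'.
Qed.

(** * Heisenberg relations and the normal form of automorphisms *)

Section Galois.
Variables x y z : {rmorphism algC -> algC}.
Hypothesis G : heis_gen x y z.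

Lemma heis_eqR (f g : {rmorphism algC -> algC}) :
  f zeta3 = g zeta3 -> f a1 = g a1 -> f a2 = g a2 -> f t = g t ->
  forall w, R w -> f w = g w.
Proof.
by move=> fz f1 f2 ft; apply: eq_genfield => w; rewrite !inE => /or4P[] /eqP ->.
Qed.

Lemma heis_fix_zeta3 : [/\ x zeta3 = zeta3, y zeta3 = zeta3 & z zeta3 = zeta3].
Proof.
split; [exact: (heis_x_k G kk_zeta3) | exact: (heis_y_K1 G K1_zeta3) |].
exact: (heis_z_K2 G (K1_K2 K1_zeta3)).
Qed.

Lemma heis_x_K1 : forall w, K1 w -> x w = tau w.
Proof.
apply: eq_genfield => w; rewrite !inE => /orP[] /eqP ->.
  by rewrite (heis_x_k G kk_zeta3) (Htau_k kk_zeta3).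
by rewrite (heis_x1 G) Htau_a1.
Qed.

Lemma heis_xu : x u = a2 * beta / tau alpha.
Proof. by rewrite Du !rmorphM fmorphV (heis_x2 G) (heis_x_k G kbeta) (heis_x_K1 Kalpha). Qed.

Lemma heis_yu : y u = zeta3 ^+ 2 * u.
Proof.
rewrite Du !rmorphM fmorphV (heis_y2 G) (heis_y_K1 G (kk_K1 kbeta)).
by rewrite (heis_y_K1 G Kalpha) !mulrA.
Qed.

Lemma R_u : R u.
Proof.
have HR := genfield_subring [:: zeta3; a1; a2; t].
have := subfieldV (genfield_subfield _) (K1_R Kalpha); have := K2_R K2_a2.
by have := K1_R (kk_K1 kbeta); rewrite Du => *; mem HR.
Qed.

Lemma heis_zu : z u = u.
Proof.
apply: (heis_z_K2 G); have := K2_a2; have := K1_K2 (kk_K1 kbeta).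
by have := subfieldV (genfield_subfield _) (K1_K2 Kalpha); rewrite Du => *; mem H2.
Qed.

Let HR : is_subring R := genfield_subring _.

Lemma heis_R w : R w -> [/\ R (x w), R (y w) & R (z w)].
Proof.
have [xz yz zz] := heis_fix_zeta3; have Rz := K1_R K1_zeta3.
have [R1 R2 Rt Ru] := And4 (K1_R K1_a1) (K2_R K2_a2) R_t R_u.
have HF := genfield_subfield [:: zeta3; a1; a2; t].
split; move: w H; apply: (rmorph_genfield HF) => s; rewrite !inE => /or4P[] /eqP ->.
- by rewrite xz.
- by rewrite (heis_x1 G); mem HR.
- by rewrite (heis_x2 G).
- by rewrite (heis_xt G); mem HR.
- by rewrite yz.
- by rewrite (heis_y_K1 G K1_a1).
- by rewrite (heis_y2 G); mem HR.
- by rewrite (heis_yt G).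
- by rewrite zz.
- by rewrite (heis_z_K2 G (K1_K2 K1_a1)).
- by rewrite (heis_z_K2 G K2_a2).
- by rewrite (heis_zt G); mem HR.
Qed.

(** On [t] the relation reads u (x u) (x^2 u) = 1, that is a2^3 beta^3 = N(alpha), the norm
    condition on alpha. *)
Lemma heis_x3 w : R w -> x (x (x w)) = w.
Proof.
have [xz _ _] := heis_fix_zeta3; move: w.
have nz_a := nz_alpha; have nz_ta : tau alpha != 0 by rewrite fmorph_eq0.
have nz_tta : tau (tau alpha) != 0 by rewrite fmorph_eq0.
apply: (@heis_eqR (x \o (x \o x)) idfun); rewrite /= ?xz //.
- by rewrite !(heis_x1 G, xz, rmorphM x) zeta3_mul3.
- by rewrite !(heis_x2 G).
rewrite (heis_xt G) rmorphM (heis_xt G) heis_xu !rmorphM (heis_xt G) heis_xu fmorphV.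
rewrite (heis_x2 G) (heis_x_k G kbeta) (heis_x_K1 (tau_K1 Kalpha)) Du.
transitivity (t * (a2 ^+ 3 * beta ^+ 3) / (alpha * tau alpha * tau (tau alpha))).
  by field; rewrite nz_a nz_ta nz_tta.
rewrite Ha2 Nalpha mulfK //.
by rewrite mulf_neq0 ?nz2 ?expf_neq0 ?beta_neq0.
Qed.

Lemma heis_y3 w : R w -> y (y (y w)) = w.
Proof.
have [_ yz _] := heis_fix_zeta3; move: w.
apply: (@heis_eqR (y \o (y \o y)) idfun); rewrite /= ?yz ?(heis_yt G) //.
  by rewrite !(heis_y_K1 G K1_a1).
rewrite !(heis_y2 G, yz, rmorphXn y, rmorphM y).
transitivity ((zeta3 ^+ 3) ^+ 2 * a2); first by ring.
by rewrite zeta3_cube expr1n mul1r.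
Qed.

Lemma heis_z3 w : R w -> z (z (z w)) = w.
Proof.
have [_ _ zz] := heis_fix_zeta3; move: w.
apply: (@heis_eqR (z \o (z \o z)) idfun); rewrite /= ?zz //.
- by rewrite !(heis_z_K2 G (K1_K2 K1_a1)).
- by rewrite !(heis_z_K2 G K2_a2).
by rewrite !(heis_zt G, zz, rmorphM z) zeta3_mul3.
Qed.

Lemma heis_xz w : R w -> x (z w) = z (x w).
Proof.
have [xz _ zz] := heis_fix_zeta3; move: w.
apply: (@heis_eqR (x \o z) (z \o x)); rewrite /= ?xz ?zz ?xz ?zz //.
- by rewrite (heis_z_K2 G (K1_K2 K1_a1)) (heis_x1 G) rmorphM zz (heis_z_K2 G (K1_K2 K1_a1)).
- by rewrite (heis_z_K2 G K2_a2) (heis_x2 G) (heis_z_K2 G K2_a2).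
by rewrite (heis_zt G) rmorphM xz (heis_xt G) rmorphM (heis_zt G) heis_zu mulrA.
Qed.

Lemma heis_yz w : R w -> y (z w) = z (y w).
Proof.
have [_ yz zz] := heis_fix_zeta3; move: w.
apply: (@heis_eqR (y \o z) (z \o y)); rewrite /= ?yz ?zz ?yz ?zz //.
- by rewrite (heis_z_K2 G (K1_K2 K1_a1)) (heis_y_K1 G K1_a1) (heis_z_K2 G (K1_K2 K1_a1)).
- by rewrite (heis_z_K2 G K2_a2) (heis_y2 G) rmorphM rmorphXn zz (heis_z_K2 G K2_a2).
by rewrite (heis_zt G) rmorphM yz (heis_yt G) (heis_zt G).
Qed.

Lemma heis_comm w : R w -> x (y w) = y (x (z w)).
Proof.
have [xz yz zz] := heis_fix_zeta3; move: w.
apply: (@heis_eqR (x \o y) (y \o (x \o z))); rewrite /= ?zz ?yz ?xz ?yz //.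
- rewrite (heis_z_K2 G (K1_K2 K1_a1)) (heis_y_K1 G K1_a1) (heis_x1 G) rmorphM yz.
  by rewrite (heis_y_K1 G K1_a1).
- by rewrite (heis_z_K2 G K2_a2) (heis_x2 G) (heis_y2 G) rmorphM rmorphXn xz (heis_x2 G).
rewrite (heis_zt G) (heis_yt G) (heis_xt G) (rmorphM x zeta3) xz (heis_xt G).
rewrite (rmorphM y zeta3) yz (rmorphM y t) (heis_yt G) heis_yu.
by rewrite -[LHS]mul1r -zeta3_cube; ring.
Qed.

Lemma heis_xR w : R w -> R (x w). Proof. by case/heis_R. Qed.
Lemma heis_yR w : R w -> R (y w). Proof. by case/heis_R. Qed.
Lemma heis_zR w : R w -> R (z w). Proof. by case/heis_R. Qed.

Section Iter.
Variable f : {rmorphism algC -> algC}.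
Hypothesis fR : forall w, R w -> R (f w).

Lemma rmorph_iter_R n w : R w -> R (rmorph_iter f n w).
Proof. by move=> Rw; elim: n => //= n; apply: fR. Qed.

Lemma rmorph_iterD m n w : rmorph_iter f (m + n) w = rmorph_iter f m (rmorph_iter f n w).
Proof. by elim: m => //= m ->. Qed.

Lemma rmorph_iter_mod3 n w : (forall w, R w -> f (f (f w)) = w) ->
  R w -> rmorph_iter f (n %% 3) w = rmorph_iter f n w.
Proof.
move=> f3 Rw; rewrite {2}(divn_eq n 3) addnC rmorph_iterD; congr (rmorph_iter f _ _).
by elim: (n %/ 3)%N => //= m IHm; rewrite f3 //; apply: rmorph_iter_R.
Qed.

Lemma rmorph_iter_commute (g : {rmorphism algC -> algC}) n w :
  (forall w, R w -> g (f w) = f (g w)) -> R w ->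
  g (rmorph_iter f n w) = rmorph_iter f n (g w).
Proof.
by move=> gf Rw; elim: n => //= n <-; apply: gf; apply: rmorph_iter_R.
Qed.
End Iter.

(** Natural exponents keep composition free of reductions modulo 3; these are made once, in
    [heis_word_mod3]. *)
Definition heis_word k m n : {rmorphism algC -> algC} :=
  rmorph_iter z n \o (rmorph_iter y m \o rmorph_iter x k).

Lemma heis_wordE k m n w :
  heis_word k m n w = rmorph_iter z n (rmorph_iter y m (rmorph_iter x k w)).
Proof. by []. Qed.

Lemma heis_iter_xz k n w : R w ->
  rmorph_iter x k (rmorph_iter z n w) = rmorph_iter z n (rmorph_iter x k w).
Proof.
move=> Rw; apply: (rmorph_iter_commute heis_zR) => // {Rw}w Rw.
by rewrite (rmorph_iter_commute heis_xR (g := z)) // => v Rv; rewrite heis_xz.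
Qed.

Lemma heis_iter_yz m n w : R w ->
  rmorph_iter y m (rmorph_iter z n w) = rmorph_iter z n (rmorph_iter y m w).
Proof.
move=> Rw; apply: (rmorph_iter_commute heis_zR) => // {Rw}w Rw.
by rewrite (rmorph_iter_commute heis_yR (g := z)) // => v Rv; rewrite heis_yz.
Qed.

(** Each exchange of an x with a y produces one central z, hence k m of them: the product term in
    the corner entry of a matrix product. *)
Lemma heis_iter_xy k m w : R w -> rmorph_iter x k (rmorph_iter y m w) =
  rmorph_iter z (k * m) (rmorph_iter y m (rmorph_iter x k w)).
Proof.
have step n v : R v -> x (rmorph_iter y n v) = rmorph_iter z n (rmorph_iter y n (x v)).
  move=> Rv; have Rxv := heis_xR Rv.
  have Riy l := rmorph_iter_R heis_yR l Rv.
  elim: n => // n IHn; rewrite !rmorph_iterS (heis_comm (Riy n)).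
  rewrite (heis_xz (Riy n)) IHn heis_yz; last first.
    by apply: (rmorph_iter_R heis_zR); apply: (rmorph_iter_R heis_yR).
  by congr (z _); apply: (heis_iter_yz 1); apply: (rmorph_iter_R heis_yR).
move=> Rw; elim: k => // k IHk; rewrite !rmorph_iterS IHk.
have Rxk := rmorph_iter_R heis_xR k Rw.
rewrite (heis_iter_xz 1); last by apply: (rmorph_iter_R heis_yR).
by rewrite (step _ _ Rxk) -rmorph_iterD mulSn addnC.
Qed.

Lemma heis_wordM k m n k' m' n' w : R w ->
  heis_word (k + k') (m + m') (n + n' + k * m') w =
  heis_word k m n (heis_word k' m' n' w).
Proof.
move=> Rw; rewrite !heis_wordE.
have Rx l v := @rmorph_iter_R x heis_xR l v.
have Ry l v := @rmorph_iter_R y heis_yR l v.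
have Rz l v := @rmorph_iter_R z heis_zR l v.
rewrite heis_iter_xz; last by auto.
rewrite heis_iter_xy; last by auto.
by rewrite !heis_iter_yz; auto; rewrite !rmorph_iterD.
Qed.

Lemma heis_word_mod3 k m n w : R w ->
  heis_word (k %% 3) (m %% 3) (n %% 3) w = heis_word k m n w.
Proof.
move=> Rw; rewrite !heis_wordE.
have Rx l v := @rmorph_iter_R x heis_xR l v.
have Ry l v := @rmorph_iter_R y heis_yR l v.
rewrite (rmorph_iter_mod3 heis_xR _ heis_x3) //.
rewrite (rmorph_iter_mod3 heis_yR _ heis_y3); last by auto.
by rewrite (rmorph_iter_mod3 heis_zR _ heis_z3); auto.
Qed.

Lemma heis_word_a1 k m n : heis_word k m n a1 = zeta3 ^+ k * a1.
Proof.
have [xz yz zz] := heis_fix_zeta3.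
rewrite heis_wordE (rmorph_iter_root (j := 1) _ xz (heis_x1 G)) mul1n.
have K : K1 (zeta3 ^+ k * a1) by have := K1_a1; have := K1_zeta3 => *; mem H1.
rewrite (rmorph_iter_fix _ (heis_y_K1 G K)).
exact/rmorph_iter_fix/(heis_z_K2 G (K1_K2 K)).
Qed.

Lemma heis_word_a2 k m n : heis_word k m n a2 = zeta3 ^+ (2 * m) * a2.
Proof.
have [xz yz zz] := heis_fix_zeta3.
rewrite heis_wordE (rmorph_iter_fix _ (heis_x2 G)) (rmorph_iter_root _ yz (heis_y2 G)).
apply: rmorph_iter_fix; apply: (heis_z_K2 G).
have := K2_a2; have := K1_K2 K1_zeta3 => *; mem H2.
Qed.

Lemma heis_word_t k m n : heis_word k m n t = zeta3 ^+ n * heis_word k m 0 t.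
Proof.
have [xz yz zz] := heis_fix_zeta3.
have Rx l v := @rmorph_iter_R x heis_xR l v.
rewrite !heis_wordE -heis_iter_yz; last exact: Rx _ _ R_t.
rewrite -heis_iter_xz; last exact: R_t.
rewrite (rmorph_iter_root (j := 1) _ zz (heis_zt G)) mul1n !(rmorphM (rmorph_iter _ _)) /=.
have fz l : y (zeta3 ^+ l) = zeta3 ^+ l by rewrite rmorphXn yz.
have fz' l : x (zeta3 ^+ l) = zeta3 ^+ l by rewrite rmorphXn xz.
by rewrite (rmorph_iter_fix _ (fz' n)) (rmorph_iter_fix _ (fz n)).
Qed.

Lemma heis_word_kk k m n w : kk w -> heis_word k m n w = w.
Proof.
move=> kw; rewrite heis_wordE (rmorph_iter_fix _ (heis_x_k G kw)).
rewrite (rmorph_iter_fix _ (heis_y_K1 G (kk_K1 kw))).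
exact/rmorph_iter_fix/(heis_z_K2 G (K1_K2 (kk_K1 kw))).
Qed.

Lemma heis_word_R k m n w : R w -> R (heis_word k m n w).
Proof.
move=> Rw; rewrite heis_wordE.
exact: rmorph_iter_R heis_zR _ _ (rmorph_iter_R heis_yR _ (rmorph_iter_R heis_xR _ Rw)).
Qed.

Lemma zeta3_exp_inj i j : zeta3 ^+ i = zeta3 ^+ j -> i = j %[mod 3].
Proof.
have [z1 z2] : zeta3 <> 1 /\ zeta3 ^+ 2 <> 1.
  split=> [z1 | z2]; move: zeta3_neq1; first by rewrite z1 subrr eqxx.
  by have := zeta3_cube; rewrite exprS z2 mulr1 => ->; rewrite subrr eqxx.
have z21 : zeta3 ^+ 2 <> zeta3.
  by move=> E; have := zeta3_cube; rewrite exprS E -expr2 => /z2.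
rewrite -(zeta3_mod i) -(zeta3_mod j).
have := ltn_pmod i (isT : 0 < 3)%N; have := ltn_pmod j (isT : 0 < 3)%N.
by case: (i %% 3)%N => [|[|[|i']]] //; case: (j %% 3)%N => [|[|[|j']]] // _ _ E;
  first [case: (z1 E) | case: (z1 (esym E)) | case: (z2 E) | case: (z2 (esym E))
       | case: (z21 E) | case: (z21 (esym E))].
Qed.

(** The exponents are read off on a1, a2 and t in turn. A word multiplies a2 by zeta3^(2m), so m = 2
    j yields 4 j = j modulo 3. Once the images of a1 agree, so do those of theta, and the images of
    t differ by a power of zeta3 that z^n supplies. *)
Lemma heis_word_surj (s : {rmorphism algC -> algC}) : (forall w, kk w -> s w = w) ->
  exists k m n, forall w, R w -> s w = heis_word k m n w.
Proof.
move=> sk; have sz := sk _ kk_zeta3.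
have [k k3 s1] : exists2 k, (k < 3)%N & s a1 = zeta3 ^+ k * a1.
  by apply: cube_root_image; rewrite Ha1; apply: sk; case: Hpi1.
have [j j3 s2] : exists2 j, (j < 3)%N & s a2 = zeta3 ^+ j * a2.
  by apply: cube_root_image; rewrite Ha2; apply: sk; case: Hpi2.
have wz m n : heis_word k m n zeta3 = zeta3 by exact: heis_word_kk kk_zeta3.
pose g := heis_word k (2 * j) 0.
have [n n3 st] : exists2 n, (n < 3)%N & s t = zeta3 ^+ n * g t.
  apply: eq_cube; rewrite -!rmorphXn Ht; move: K1_theta.
  apply: eq_genfield => w; rewrite !inE => /orP[] /eqP ->; first by rewrite sz wz.
  by rewrite s1 heis_word_a1.
exists k, (2 * j)%N, n; apply: heis_eqR.
- by rewrite sz wz.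
- by rewrite s1 heis_word_a1.
- rewrite s2 heis_word_a2; congr (_ * _); rewrite mulnA -[(2 * 2)%N]/(3 + 1)%N mulnDl mul1n exprD.
  by rewrite exprM zeta3_cube expr1n mul1r.
by rewrite st -heis_word_t.
Qed.

Lemma heis_galois : galois_over kk R.
Proof.
move=> s /heis_word_surj[k [m [n sE]]] w Rw; rewrite (sE _ Rw).
exact: heis_word_R.
Qed.

End Galois.

Lemma R_galois : galois_over kk R.
Proof. by have [x [y [z G]]] := heis_gen_exists; apply: heis_galois G. Qed.

(** * The isomorphism with unitriangular matrices *)

Lemma unitri_diag (M : 'M['F_3]_3) i : unitri M -> M i i = 1.
Proof. by move=> /forallP/(_ i)/forallP/(_ i)/andP[_]; rewrite eqxx => /eqP. Qed.

Lemma unitri_lt (M : 'M['F_3]_3) (i j : 'I_3) : unitri M -> (j < i)%N -> M i j = 0.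
Proof. by move=> /forallP/(_ i)/forallP/(_ j)/andP[/implyP Mij _] /Mij/eqP. Qed.

Lemma R_gal_iso_N3 : gal_iso_N3 kk R.
Proof.
have [x [y [z G]]] := heis_gen_exists.
pose o1 : 'I_3 := @Ordinal 3 1 isT; pose o2 : 'I_3 := @Ordinal 3 2 isT.
have FD (a b : 'F_3) : ((a + b)%R : nat) = ((a + b)%N %% 3)%N by [].
have FM (a b : 'F_3) : ((a * b)%R : nat) = ((a * b)%N %% 3)%N by [].
have Flt (a : 'F_3) : (a < 3)%N by exact: ltn_ord.
pose f (M : 'M['F_3]_3) := heis_word x y z (M ord0 o1) (M o1 o2) (M ord0 o2).
have sum3 (M N : 'M['F_3]_3) i j :
    (M *m N) i j = M i ord0 * N ord0 j + M i o1 * N o1 j + M i o2 * N o2 j.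
  rewrite mxE !big_ord_recl big_ord0 addr0 addrA.
  by congr (_ + _ * _ + _ * _); congr (fun_of_matrix _ _ _); apply: val_inj.
exists f; split.
- by move=> M _ w; apply: (heis_word_kk G).
- move=> M N uM uN w Rw; rewrite -(heis_wordM G) // -(heis_word_mod3 G) //.
  rewrite /f !sum3 !(unitri_diag _ uM) !(unitri_diag _ uN).
  rewrite (unitri_lt uN (isT : (o1 < o2)%N)) (unitri_lt uM (isT : (@ord0 2 < o1)%N)).
  rewrite mul0r mulr0 !mul1r !mulr1 addr0 add0r !FD FM modnDmr modnDml.
  by rewrite addnC [(N o1 o2 + _)%N]addnC [(_ + M ord0 o2)%N]addnC addnA.
- move=> M N uM uN /eqP neqMN; apply: NNPP => no; apply: neqMN.
  have fE w : R w -> f M w = f N w.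
    by move=> Rw; apply/eqP/negPn/negP=> ne; apply: no; exists w.
  have E01 : M ord0 o1 = N ord0 o1.
    have /(mulIf a1_neq0)/zeta3_exp_inj : zeta3 ^+ M ord0 o1 * a1 = zeta3 ^+ N ord0 o1 * a1.
      by have := fE _ (K1_R K1_a1); rewrite !(heis_word_a1 G).
    by rewrite !modn_small ?Flt // => /val_inj.
  have E12 : M o1 o2 = N o1 o2.
    have /(mulIf a2_neq0)/zeta3_exp_inj :
        zeta3 ^+ (2 * M o1 o2) * a2 = zeta3 ^+ (2 * N o1 o2) * a2.
      by have := fE _ (K2_R K2_a2); rewrite !(heis_word_a2 G).
    by have := Flt (M o1 o2); have := Flt (N o1 o2) => ? ? ?; apply: val_inj => /=; lia.
  have E02 : M ord0 o2 = N ord0 o2.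
    have := fE _ R_t; rewrite /f (heis_word_t G) [RHS](heis_word_t G) E01 E12.
    have nz : heis_word x y z (N ord0 o1) (N o1 o2) 0 t != 0 by rewrite fmorph_eq0 t_neq0.
    by move/(mulIf nz)/zeta3_exp_inj; rewrite !modn_small ?Flt // => /val_inj.
  apply/matrixP=> i j; have [lt_ji | lt_ij | /val_inj <-] := ltngtP j i.
  - by rewrite !unitri_lt.
  - move: lt_ij; case: i => [[|[|[|i]]] // i3]; case: j => [[|[|[|j]]] // j3] _.
    + by move: E01; congr (_ = _); congr (fun_of_matrix _ _ _); apply: val_inj.
    + by move: E02; congr (_ = _); congr (fun_of_matrix _ _ _); apply: val_inj.
    + by move: E12; congr (_ = _); congr (fun_of_matrix _ _ _); apply: val_inj.
  - by rewrite !unitri_diag.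
move=> s /(heis_word_surj G)[k [m [n sE]]].
pose M : 'M['F_3]_3 := \matrix_(i, j) if i == j then 1 else
  if (i == ord0) && (j == o1) then inZp k else if (i == o1) && (j == o2) then inZp m else
  if (i == ord0) && (j == o2) then inZp n else 0.
exists M; split; last by move=> w Rw; rewrite (sE _ Rw) /f !mxE -(heis_word_mod3 G).
apply/forallP=> i; apply/forallP=> j; rewrite mxE; apply/andP; split; apply/implyP.
  by case: i => [[|[|[|i]]] // i3]; case: j => [[|[|[|j]]] // j3].
by move=> ->.
Qed.


(** * Ramification *)

Section Ramification.
Hypothesis pi1_prime : is_prime_ideal Ok (pideal Ok pi1).
Hypothesis ndvd' : ~ pideal Ok pi1 pi2.
Variables (g1 g2 g3 eta : algC) (P B : algC -> Prop) (a b : nat).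
Notation O1 := (ints K1).
Notation OR := (ints R).
Hypotheses (Og1 : Ok g1) (Og2 : Ok g2).
Hypotheses (Dg1 : pi1 = 1 + (1 - zeta3) ^+ 3 * g1) (Dg2 : pi2 = 1 + (1 - zeta3) ^+ 3 * g2).
Hypotheses (Aalpha : alpha \in Aint) (Oeta : O1 eta) (Ag3 : g3 \in Aint).
Hypothesis Dg3 : theta = eta ^+ 3 + (1 - zeta3) ^+ 3 * g3.
Hypotheses (HP : is_ideal O1 P) (HB : is_ideal O1 B) (P2 : P pi2).
Hypotheses (cop3 : ideal_coprime O1 B (pideal O1 3)) (dvd3b : (3 %| b)%N).
Hypothesis Ealpha :
  ideal_eq (pideal O1 alpha) (ideal_mul O1 (ideal_exp O1 P a) (ideal_exp O1 B b)).

Let HK1 : is_subfield K1 := genfield_subfield _.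
Let HK2 : is_subfield K2 := genfield_subfield _.
Let HR : is_subfield R := genfield_subfield _.
Let HO1 : is_subring O1 := ints_subring HK1.
Let HOR : is_subring OR := ints_subring HR.
Let HOk : is_subring Ok := Ok_subring.

Lemma Ok_O1 v : Ok v -> O1 v.
Proof. by case=> kv Av; split=> //; apply: kk_K1. Qed.
Lemma O1_OR v : O1 v -> OR v.
Proof. by case=> kv Av; split=> //; apply: K1_R. Qed.
Lemma O1_tau v : O1 v -> O1 (tau v).
Proof. by case=> kv Av; split; [exact: tau_K1 | rewrite Aint_aut]. Qed.
Lemma O1_zeta3 : O1 zeta3. Proof. exact: ints_zeta3 K1_zeta3. Qed.
Lemma O1_alpha : O1 alpha. Proof. by []. Qed.

Lemma Aint_a1 : a1 \in Aint. Proof. by apply: Aint_cube; rewrite Ha1; case: Hpi1. Qed.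
Lemma Aint_a2 : a2 \in Aint. Proof. by apply: Aint_cube; rewrite Ha2; case: Hpi2. Qed.

Section PrimeOfExtension.
Variables (F q : algC -> Prop).
Hypotheses (HF : is_subfield F) (Hq : is_prime_ideal (ints F) q) (K1F : forall v, K1 v -> F v).
Let HO : is_subring (ints F) := ints_subring HF.

Lemma O1_ints v : O1 v -> ints F v.
Proof. by case=> kv Av; split=> //; apply: K1F. Qed.

(** (1 - zeta3)^2 = -3 zeta3, so pi is 1 modulo 3. *)
Lemma not_3_of_congruence pi g : Ok g -> pi = 1 + (1 - zeta3) ^+ 3 * g ->
  q pi -> ~ q 3.
Proof.
move=> Og Dpi qpi q3; apply: (prime1 Hq).
have Oz := O1_ints O1_zeta3; have Og' := O1_ints (Ok_O1 Og).
have -> : 1 = pi + 3 * (zeta3 * (1 - zeta3) * g).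
  rewrite Dpi exprS subr1_zeta3_sqr; ring.
by apply: (primeD Hq) => //; apply: (primeMl Hq) => //; mem HO.
Qed.

Lemma not_both : q pi1 -> ~ q pi2.
Proof.
move=> q1 q2; apply: ndvd'.
have OkF v : Ok v -> ints F v by move/Ok_O1/O1_ints.
exact: (Ok_prime_max Hpi1 nz1 pi1_prime OkF HO Hq q1 Hpi2 q2).
Qed.

Lemma not_a1 : ~ q pi1 -> ~ q a1.
Proof.
move=> nq qa; apply: nq; rewrite -Ha1 exprS; apply: (primeMl Hq) => //.
have Oa1 : ints F a1 by apply: O1_ints; split; [exact: K1_a1 | exact: Aint_a1].
by mem HO.
Qed.

Lemma K1_step u0 : Ok u0 -> ~ q pi1 -> locally_in q kk u0 -> locally_in q K1 u0.
Proof.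
move=> Ou0 nq1.
apply: (@kummer_congruence_step F q kk K1 a1 u0 1 g1 tau Hq _ _ _ _ K1F Htau_k Htau_a1) => //.
- exact: genfield_subfield.
- exact: kk_zeta3.
- exact: kk_K1.
- exact: tau_K1.
- exact: K1_kummer.
- exact: Ok_O1.
- exact: K1_a1.
- exact: not_a1.
- by mem HOk.
- by case: Og1.
- by rewrite Ha1 expr1n.
Qed.

Lemma locally_in_kk u0 : Ok u0 -> (forall v, Ok v -> q v -> pideal Ok u0 v) -> locally_in q kk u0.
Proof.
move=> Ou0 qu; exists 1; first by split; [mem HOk | exact: (prime1 Hq)].
by move=> v Ov /(qu _ Ov)/(pidealP HOk _ Ou0)[r Or ->]; exists r; rewrite ?mul1r.
Qed.
End PrimeOfExtension.

(** (alpha) contains pi2^a b0^b, where b0 in B is 1 modulo 3 by coprimality, as is pi2; neither lies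
    in a prime above 3. *)
Lemma alpha_not_above_3 (q : algC -> Prop) : is_prime_ideal O1 q -> q 3 -> ~ q alpha.
Proof.
move=> Hq q3 qal; have O3 : O1 3 by mem HO1.
have [b0 Bb0 [r Or D1]] := ideal_coprimeP HO1 HB O3 cop3.
have nq2 : ~ q pi2.
  by move=> /(not_3_of_congruence HK1 Hq (fun v => id) Og2 Dg2); apply.
have nqb : ~ q b0.
  by move=> qb; apply: (prime1 Hq); rewrite D1; apply: (primeD Hq) => //; apply: (primeMl Hq).
case: (HB) => BO _ _ _; have Ob0 := BO _ Bb0; have O2 := Ok_O1 Hpi2.
have : pideal O1 alpha (pi2 ^+ a * b0 ^+ b).
  by apply/Ealpha; apply: ideal_mul_mem; apply: ideal_expX.
case/(pidealP HO1 _ O1_alpha) => v Ov E.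
have : q (pi2 ^+ a * b0 ^+ b) by rewrite E; apply: (primeMl Hq).
apply: (prime_notM Hq); [by mem HO1 | by mem HO1 | exact: (prime_notX HO1 Hq)
  | exact: (prime_notX HO1 Hq)].
Qed.

(** B^b contributes a cube, so what is sought is a local generator of P^a at q. If pi2, or some s0
    in P, is outside q, its a-th power is a unit at q and serves. Otherwise q lies above pi2 and
    contains P; by [K1_step] pi2 generates q locally, hence also P, which contains pi2. *)
Lemma alpha_local (q : algC -> Prop) : is_prime_ideal O1 q -> ~ q 3 ->
  exists g w e n, [/\ O1 g, O1 w, O1 e & [/\ ~ q w, ~ q e &
     alpha * w = e * pi2 ^+ n * g ^+ 3]].
Proof.
move=> Hq nq3; have O2 := Ok_O1 Hpi2; have Oal := O1_alpha.
have factor := local_cube_factor HO1 HP HB Hq Oal nz_alpha dvd3b Ealpha.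
case: (HP) => PO _ _ _; have [PaO _ _ _] := ideal_exp_ideal HO1 a HP.
have [q2 | nq2] := classic (q pi2); last first.
  have [||| x Px | g [w [Og Ow nqw E]]] := factor (pi2 ^+ a) (pi2 ^+ a).
  - exact: ideal_expX.
  - by mem HO1.
  - exact: (prime_notX HO1 Hq).
  - by exists x => //; apply: PaO.
  exists g, w, 1, a; rewrite mul1r; split=> //; first by mem HO1.
  by split=> //; exact: (prime1 Hq).
have [sPq | /not_all_ex_not[s0 /(imply_to_and (P s0))[Ps0 nqs0]]] :=
    classic (forall x, P x -> q x); last first.
  have Os0 := PO _ Ps0.
  have [||| x Px | g [w [Og Ow nqw E]]] := factor (s0 ^+ a) (s0 ^+ a).
  - exact: ideal_expX.
  - by mem HO1.
  - exact: (prime_notX HO1 Hq).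
  - by exists x => //; apply: PaO.
  exists g, w, (s0 ^+ a), 0%N; rewrite mulr1; split=> //; first by mem HO1.
  by split=> //; exact: (prime_notX HO1 Hq).
have nq1 : ~ q pi1 by move=> q1; apply: (not_both HK1 Hq (fun v => id) q1 q2).
have [d [Od nqd] dq] : locally_in q K1 pi2.
  apply: (K1_step HK1 Hq (fun v => id) Hpi2 nq1); apply: (locally_in_kk Hq Hpi2).
  exact: (Ok_prime_max Hpi2 nz2 pi2_prime Ok_O1 HO1 Hq q2).
have [||| x Px | g [w [Og Ow nqw E]]] := factor (pi2 ^+ a) (d ^+ a).
- exact: ideal_expX.
- by mem HO1.
- exact: (prime_notX HO1 Hq).
- apply: (ideal_exp_scale HO1 HP HP Od O2 _ Px) => v Pv.
  by apply: dq; [exact: PO | exact: sPq].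
exists g, w, 1, a; rewrite mul1r; split=> //; first by mem HO1.
by split=> //; exact: (prime1 Hq).
Qed.

Variable Q : algC -> Prop.
Hypothesis HQ : is_prime_ideal OR Q.

Let Q1 v := Q v /\ O1 v.
Let HQ1 : is_prime_ideal O1 Q1 := prime_restrict HO1 O1_OR HQ.

(** The conjugate prime: tau alpha behaves at [Q1] as alpha does at [Q1t], so the results on alpha
    cover both factors of theta. *)
Let Q1t v := O1 v /\ Q1 (tau v).
Let HQ1t : is_prime_ideal O1 Q1t := prime_preim HO1 O1_tau HQ1.

Lemma theta_not_above_3 : Q 3 -> ~ Q theta.
Proof.
move=> Q3; have O3 : O1 3 by mem HO1.
have nal := alpha_not_above_3 HQ1 (conj Q3 O3).
have nalt : ~ Q1t alpha.
  by apply: (alpha_not_above_3 HQ1t); split=> //; rewrite rmorph_nat.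
have Oal := O1_alpha; have Otal := O1_tau Oal; have Oz := O1_zeta3.
have nQz : ~ Q1 zeta3.
  move=> Qz; apply: (prime1 HQ1); rewrite -zeta3_cube exprS; apply: (primeMl HQ1) => //.
  by mem HO1.
move=> Qth; suff : ~ Q1 theta by apply; split=> //; rewrite Dtheta; mem HO1.
rewrite Dtheta; apply: (prime_notM HQ1) => //; [by mem HO1 | | by move=> ?; apply: nalt].
apply: (prime_notM HQ1); [by mem HO1 | by mem HO1 | exact: (prime_notX HO1 HQ1)
  | exact: (prime_notX HO1 HQ1)].
Qed.

Lemma theta_local : ~ Q 3 -> exists g w e n,
  [/\ O1 g, O1 w, O1 e & [/\ ~ Q w, ~ Q e, g != 0 & theta * w = e * pi2 ^+ n * g ^+ 3]].
Proof.
move=> nQ3; have Oz := O1_zeta3.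
have nQz : ~ Q1 zeta3.
  move=> Qz; apply: (prime1 HQ1); rewrite -zeta3_cube exprS; apply: (primeMl HQ1) => //.
  by mem HO1.
have [|g [w [e [n [Og Ow Oe [nQw nQe E]]]]]] := alpha_local HQ1; first by case.
have [|g' [w' [e' [n' [Og' Ow' Oe' [nQw' nQe' E']]]]]] := alpha_local HQ1t.
  by case=> _; rewrite rmorph_nat => -[].
have [Otg Otw Ote] := And3 (O1_tau Og') (O1_tau Ow') (O1_tau Oe').
have nQtw : ~ Q1 (tau w') by move=> ?; apply: nQw'.
have nQte : ~ Q1 (tau e') by move=> ?; apply: nQe'.
have t2 : tau pi2 = pi2 by apply: Htau_k; case: Hpi2.
have {}E' : tau alpha * tau w' = tau e' * pi2 ^+ n' * tau g' ^+ 3.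
  by rewrite -rmorphM E' (rmorphM tau (e' * pi2 ^+ n')) (rmorphM tau e') 2!rmorphXn t2.
have nz_w v : ~ Q1 v -> v != 0.
  by move=> nv; apply/eqP=> v0; case: nv; rewrite v0; exact: (prime0 HQ1).
have nz_g : g != 0.
  have : alpha * w != 0 by exact: mulf_neq0 nz_alpha (nz_w _ nQw).
  by apply: contra_neq => g0; rewrite E g0 expr0n mulr0.
have nz_tg : tau g' != 0.
  have : tau alpha * tau w' != 0.
    by apply: mulf_neq0 (nz_w _ nQtw); rewrite fmorph_eq0.
  by apply: contra_neq => g0; rewrite E' g0 expr0n mulr0.
exists (g ^+ 2 * tau g'), (w ^+ 2 * tau w'), (zeta3 ^+ c * e ^+ 2 * tau e'), (n * 2 + n')%N.
split; [by mem HO1 | by mem HO1 | by mem HO1 |]; split.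
- move=> Qw; suff : ~ Q1 (w ^+ 2 * tau w') by apply; split=> //; mem HO1.
  apply: (prime_notM HQ1) => //; [by mem HO1 | exact: (prime_notX HO1 HQ1)].
- move=> Qe; suff : ~ Q1 (zeta3 ^+ c * e ^+ 2 * tau e') by apply; split=> //; mem HO1.
  apply: (prime_notM HQ1) => //; first by mem HO1.
  apply: (prime_notM HQ1); [by mem HO1 | by mem HO1 | exact: (prime_notX HO1 HQ1)
    | exact: (prime_notX HO1 HQ1)].
- by rewrite mulf_neq0 ?expf_neq0.
rewrite Dtheta.
transitivity (zeta3 ^+ c * (alpha * w) ^+ 2 * (tau alpha * tau w')); first by ring.
rewrite E E' exprD exprM; ring.
Qed.

(** * Climbing the tower at a prime of R *)

Section Steps.
Variables (x y z : {rmorphism algC -> algC}).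
Hypothesis G : heis_gen x y z.

Lemma R_kummer w : R w -> kummer_span K2 t w.
Proof.
move: w; apply: (@kummer_genfield K2 t z HK2 _ _ (heis_z_K2 G) (heis_zt G)) => [||w].
- exact: K1_K2 K1_zeta3.
- by rewrite Ht; apply: K1_K2 K1_theta.
rewrite !inE => /or4P[] /eqP ->; [left | left | left | by right].
- exact: K1_K2 K1_zeta3.
- exact: K1_K2 K1_a1.
- exact: K2_a2.
Qed.

Lemma R_step u0 : ints K2 u0 -> locally_in Q K2 u0 -> locally_in Q R u0.
Proof.
move=> [Ku Au]; have OR0 : OR u0 by split=> //; apply: K2_R.
have Kz := K1_K2 K1_zeta3; have zR := heis_zR G.
have [_ Ath] : O1 theta.
  have := O1_alpha; have := O1_tau O1_alpha; have := O1_zeta3.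
  by rewrite Dtheta => *; mem HO1.
have At : t \in Aint by apply: Aint_cube; rewrite Ht.
have ORt : OR t by split=> //; exact: R_t.
have [Qth | nQth] := classic (Q theta); last first.
  apply: (@kummer_congruence_step R Q K2 R t u0 eta g3 z HQ HK2 HR Kz K2_R (fun v => id)
    (heis_z_K2 G) (heis_zt G) zR R_kummer OR0 R_t) => //; last by rewrite Ht.
    by move=> Qt; apply: nQth; rewrite -Ht exprS; apply: (primeMl HQ) => //; mem HOR.
  by case: Oeta => Ke Ae; split=> //; apply: K1_K2.
have nQ3 : ~ Q 3 by move/theta_not_above_3.
have [g [w [e [n [Og Ow Oe [nQw nQe nz_g E]]]]]] := theta_local nQ3.
have nz_a2n := expf_neq0 n a2_neq0.
(* Removing the cube root g a2^n of pi2^n g^3 would leave the cube e / w; the extra factor w turns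
   it into e w^2, integral and outside Q. *)
pose t' := t * (w / (g * a2 ^+ n)).
have K2' : K2 (w / (g * a2 ^+ n)).
  have K2g : K2 g by case: Og => Kg _; apply: K1_K2.
  have K2w : K2 w by case: Ow => Kw _; apply: K1_K2.
  have := K2_a2 => Ka2; have KI : K2 (g * a2 ^+ n)^-1 by apply: (subfieldV HK2); mem H2.
  by mem H2.
have zt' : z t' = zeta3 * t'.
  by rewrite /t' rmorphM (heis_zt G) (heis_z_K2 G K2') mulrA.
have t'3 : t' ^+ 3 = e * w ^+ 2.
  rewrite /t' !exprMn exprVn exprMn -exprM mulnC exprM Ha2 Ht.
  rewrite (exprS w 2) mulrA mulrA E; field.
  by rewrite nz_g expf_neq0.
have [OwR OeR] := (O1_OR Ow, O1_OR Oe).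
have ORt' : OR t'.
  have [[_ Ae] [_ Aw]] := (Oe, Ow).
  split; last by apply: Aint_cube; rewrite t'3; apply: rpredM => //; apply: rpredX.
  have RK := K2_R K2'; have Rt := R_t; have HRR := subfield_subring HR.
  by rewrite /t'; mem HRR.
have nQt' : ~ Q t'.
  move=> Qt; have : Q (t' ^+ 3) by rewrite exprS; apply: (primeMl HQ) => //; mem HOR.
  rewrite t'3; apply: (prime_notM HQ) => //; first by mem HOR.
  exact: (prime_notX HOR HQ).
have Rz := K2_R Kz.
apply: (@kummer_unramified_step R Q HQ K2 R t u0 t' t' z HK2 HR Kz K2_R (fun v => id)
  (heis_z_K2 G) (heis_zt G) zR R_kummer OR0 ORt' _ zt').
  by rewrite zt'; ring.
have ORz : OR zeta3 by exact: ints_zeta3.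
apply: (prime_notM HQ) => //; first by mem HOR.
exact: (not_subr1_zeta3 HR HQ Rz nQ3).
Qed.

Lemma not_a2 : ~ Q pi2 -> ~ Q a2.
Proof.
move=> nq qa; apply: nq; rewrite -Ha2 exprS; apply: (primeMl HQ) => //.
have Oa2 : OR a2 by split; [exact: K2_R K2_a2 | exact: Aint_a2].
by mem HOR.
Qed.

Lemma K2_step u0 : ints K1 u0 -> ~ Q pi2 -> locally_in Q K1 u0 -> locally_in Q K2 u0.
Proof.
move=> [Ku Au] nq2; have [f fK fa2] := K1_aut 1.
have HR2 := H2.
apply: (@kummer_congruence_step R Q K1 K2 a2 u0 1 g2 f HQ HK1 HK2 K1_zeta3 K1_K2 K2_R fK fa2) => //.
- apply: (rmorph_genfield HK2) => s; have [Kz Ka1 Ka2] := And3 (K1_K2 K1_zeta3) (K1_K2 K1_a1) K2_a2.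
  rewrite !inE => /or3P[] /eqP ->; rewrite ?fa2 ?(fK _ K1_zeta3) ?(fK _ K1_a1) //.
  by mem HR2.
- by move=> w; exact: K2_kummer fK fa2.
- by split=> //; apply: K1_K2.
- exact: K2_a2.
- exact: not_a2.
- by mem HO1.
- by case: Og2.
- by rewrite Ha2 expr1n.
Qed.

Notation Ka2 := (genfield [:: zeta3; a2]).

Lemma heis_x_Ka2 : forall w, Ka2 w -> x w = w.
Proof.
apply: fix_genfield => w; rewrite !inE => /orP[] /eqP ->; last exact: (heis_x2 G).
exact: (heis_x_k G kk_zeta3).
Qed.

Lemma Ka2_K2 w : Ka2 w -> K2 w.
Proof.
by apply: genfield_sub => v; rewrite !inE => /orP[] ->; rewrite ?orbT.
Qed.

(** The step over k(a2) needs an automorphism fixing a2 and moving a1. This is [x], since the action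
    of [tau] on a2 is not prescribed. *)
Lemma K2_step' u0 : ints Ka2 u0 -> ~ Q pi1 -> locally_in Q Ka2 u0 -> locally_in Q K2 u0.
Proof.
move=> [Ku Au] nq1; have HR2 := H2.
have Kz : Ka2 zeta3 by apply: genfield_mem; rewrite inE eqxx.
have HKa := genfield_subfield [:: zeta3; a2].
apply: (@kummer_congruence_step R Q Ka2 K2 a1 u0 1 g1 x HQ HKa HK2 Kz Ka2_K2 K2_R
  heis_x_Ka2 (heis_x1 G)) => //.
- apply: (rmorph_genfield HK2) => s.
  have [Kz' Ka1 Ka2] := And3 (K1_K2 K1_zeta3) (K1_K2 K1_a1) K2_a2.
  rewrite !inE => /or3P[] /eqP ->; rewrite ?(heis_x_Ka2 Kz) ?(heis_x1 G) ?(heis_x2 G) //.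
  by mem HR2.
- apply: (@kummer_genfield Ka2 a1 x HKa Kz _ heis_x_Ka2 (heis_x1 G)) => [|w].
    by rewrite Ha1; apply: kk_genfield; [rewrite inE eqxx | case: Hpi1].
  rewrite !inE => /or3P[] /eqP ->; [by left | by right | left].
  by apply: genfield_mem; rewrite !inE eqxx orbT.
- by split=> //; apply: Ka2_K2.
- exact: K1_K2 K1_a1.
- exact: (not_a1 HR HQ (fun w => @K1_R w)).
- by split; [apply: subring1; exact: subfield_subring | exact: Aint1].
- by case: Og1.
- by rewrite Ha1 expr1n.
Qed.

Lemma Q_exp1 w : Q w -> ideal_exp OR Q 1 w.
Proof. by move=> Qw; rewrite -(mul1r w); apply: ideal_mul_mem => //=; mem HOR. Qed.

Lemma unramified_outside p : (exists2 w, Q w & w != 0) ->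
  ideal_eq (fun v => Q v /\ Ok v) (pideal Ok p) ->
  ~ Q pi1 -> ~ Q pi2 -> ram_index OR Q p 1.
Proof.
move=> nzQ Ep nQ1 nQ2.
(* If p were outside Ok, no ideal would contain it, and [pideal Ok p], an intersection over an empty
   family, would contain 1. *)
have Op : Ok p.
  apply: NNPP => nOp; have : pideal Ok p 1.
    by move=> I [IO _ _ _] Ip; case: nOp; apply/IO/Ip.
  by move/Ep => -[/(prime1 HQ)].
have [Qp _] : Q p /\ Ok p by apply/Ep/(pidealP HOk) => //; exists 1; [mem HOk | rewrite mulr1].
have nz_p : p != 0.
  have [l pr_l Ql] := prime_int HR HQ nzQ; have : pideal Ok p l%:R.
    by apply/Ep; split=> //; mem HOk.
  case/(pidealP HOk _ Op) => r _ Dl; apply/eqP=> p0; move/eqP: Dl.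
  by rewrite p0 mul0r pnatr_eq0 => /eqP l0; rewrite l0 in pr_l.
split; first exact: Q_exp1.
have Op1 := Ok_O1 Op; have OpR := O1_OR Op1.
have Op2 : ints K2 p by case: Op1 => Kp Ap; split=> //; apply: K1_K2.
rewrite -[p]expr1; apply: (locally_in_ram_index HR HQ OpR Qp nz_p).
apply: (R_step Op2); apply: (K2_step Op1 nQ2).
apply: (K1_step HR HQ (fun w => @K1_R w) Op nQ1).
by apply: (locally_in_kk HQ Op) => v Ov Qv; apply/Ep.
Qed.

Lemma ram_index_pi1 : Q pi1 -> ram_index OR Q pi1 3.
Proof.
move=> Qpi1; have OKR v : Ok v -> OR v by move/Ok_O1/O1_OR.
have Oa1 : O1 a1 by split; [exact: K1_a1 | exact: Aint_a1].
have Oa1R := O1_OR Oa1.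
have Qa1 : Q a1 by apply: (primeX HOR HQ (n := 3)); rewrite ?Ha1.
rewrite -Ha1; split; first exact: ideal_expX.
apply: (locally_in_ram_index HR HQ Oa1R Qa1 a1_neq0).
have nQ3 := not_3_of_congruence HR HQ (fun w => @K1_R w) Og1 Dg1 Qpi1.
have nQ2 := not_both HR HQ (fun w => @K1_R w) Qpi1.
have Oa12 : ints K2 a1 by case: Oa1 => Ka Aa; split=> //; apply: K1_K2.
apply: (R_step Oa12); apply: (K2_step Oa1 nQ2).
exact: (tame_locally_in HR HQ Hpi1 nz1 pi1_prime Ha1 HK1 kk_K1 K1_a1 (fun w => @K1_R w)
  Htau_k Htau_a1 tau_K1 (fun w => @K1_kummer w) Qpi1 nQ3).
Qed.

Lemma ram_index_pi2 : Q pi2 -> ram_index OR Q pi2 3.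
Proof.
move=> Qpi2; have OKR v : Ok v -> OR v by move/Ok_O1/O1_OR.
have HKa := genfield_subfield [:: zeta3; a2].
have Kza : Ka2 zeta3 by apply: genfield_mem; rewrite inE eqxx.
have Kaa : Ka2 a2 by apply: genfield_mem; rewrite !inE eqxx orbT.
have Oa2R : OR a2 by split; [exact: K2_R K2_a2 | exact: Aint_a2].
have Qa2 : Q a2 by apply: (primeX HOR HQ (n := 3)); rewrite ?Ha2.
rewrite -Ha2; split; first exact: ideal_expX.
apply: (locally_in_ram_index HR HQ Oa2R Qa2 a2_neq0).
have nQ3 := not_3_of_congruence HR HQ (fun w => @K1_R w) Og2 Dg2 Qpi2.
have nQ1 : ~ Q pi1 by move=> /(not_both HR HQ (fun w => @K1_R w)).
have Oa2 : ints Ka2 a2 by split=> //; exact: Aint_a2.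
have Oa22 : ints K2 a2 by split; [exact: K2_a2 | exact: Aint_a2].
apply: (R_step Oa22); apply: (K2_step' Oa2 nQ1).
have [f fK fa2] := K1_aut 1.
have fk w : kk w -> f w = w by move/kk_K1/fK.
have kKa w : kk w -> Ka2 w by apply: kk_genfield; rewrite inE eqxx.
have HRa := subfield_subring HKa.
apply: (tame_locally_in HR HQ Hpi2 nz2 pi2_prime Ha2 HKa kKa Kaa
  (fun w Kw => K2_R (Ka2_K2 Kw)) fk fa2 _ _ Qpi2 nQ3).
  apply: (rmorph_genfield HKa) => s; rewrite !inE => /orP[] /eqP ->.
    by rewrite (fk _ kk_zeta3).
  by rewrite fa2; mem HRa.
apply: (@kummer_genfield kk a2 f (genfield_subfield _) kk_zeta3 _ fk fa2) => [|w].
  by rewrite Ha2; case: Hpi2.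
by rewrite !inE => /orP[] /eqP ->; [left; exact: kk_zeta3 | right].
Qed.

End Steps.
End Ramification.
End Theta.

End Tower.

(** (alpha) contains p^a c^b with c in B congruent to 1 modulo 3, and c is nonzero since 1/3 is not
    an algebraic integer. *)
Lemma ideal_exp_product_neq0 (F : algC -> Prop) (P B : algC -> Prop) (alpha p : algC) a b :
    is_subfield F -> is_ideal (ints F) B -> ints F alpha -> P p -> p != 0 ->
    ideal_coprime (ints F) B (pideal (ints F) 3) ->
    ideal_eq (pideal (ints F) alpha)
      (ideal_mul (ints F) (ideal_exp (ints F) P a) (ideal_exp (ints F) B b)) ->
  alpha != 0.
Proof.
move=> HF HB Oal Pp nz_p cop Eal; have HO := ints_subring HF.
have O3 : ints F 3 by mem HO.
have [c Bc [r [_ Ar] D1]] := ideal_coprimeP HO HB O3 cop.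
have nz_c : c != 0.
  apply/eqP=> c0; rewrite c0 add0r in D1.
  have Dr : r = 3^-1 by rewrite -[LHS](mulKf (x := 3)) ?pnatr_eq0 // -D1 mulr1.
  have /Cint_rat_Aint/(_ Ar)/intrP[m Dm] : r \in Crat by rewrite Dr rpredV rpred_nat.
  have : (3 * m)%:~R = 1%:~R :> algC by rewrite intrM -Dm -D1.
  by move/intr_inj; lia.
have : pideal (ints F) alpha (p ^+ a * c ^+ b).
  by apply/Eal; apply: ideal_mul_mem; apply: ideal_expX.
case/(pidealP HO _ Oal) => v _ E; apply/eqP=> al0.
have : p ^+ a * c ^+ b != 0 by rewrite mulf_neq0 ?expf_neq0.
by rewrite E al0 mul0r eqxx.
Qed.

Lemma congr_in_subr1_zeta3 (O : algC -> Prop) x y : is_subring O ->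
  congr_in O x y (3 * sqrtm3) -> exists2 g, O g & x = y + (1 - zeta3) ^+ 3 * g.
Proof.
move=> HO [g [Og E]]; exists (- g); first by mem HO.
by rewrite subr1_zeta3_cube mulrNN -E addrC subrK.
Qed.

Unset Implicit Arguments.
Set Strict Implicit.

Theorem theorem4p10
  (pi1 pi2 : algC)
  (Hpi1 : normalized_prime pi1) (Hpi2 : normalized_prime pi2)
  (Hdist : ~ ideal_eq (pideal Ok pi1) (pideal Ok pi2))
  (Hloc1 : local_cube pi1 pi2) (Hloc2 : local_cube pi2 pi1)
  (a1 : algC) (Ha1 : a1 ^+ 3 = pi1)
  (tau : {rmorphism algC -> algC})
  (Htau_k : forall x, kk x -> tau x = x) (Htau_a1 : tau a1 = zeta3 * a1)
  (P : algC -> Prop)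
  (HP : is_prime_ideal (ints (genfield [:: zeta3; a1])) P) (HPp2 : P pi2)
  (theta : algC)
  (Hadm : admissible (ints (genfield [:: zeta3; a1])) tau pi2 P theta)
  (a2 t t2 t3 : algC)
  (Ha2 : a2 ^+ 3 = pi2) (Ht : t ^+ 3 = theta)
  (Ht2 : t2 ^+ 3 = tau theta) (Ht3 : t3 ^+ 3 = tau (tau theta)) :
  let R := genfield [:: zeta3; a1; a2; t] in
  [/\ (* (1) *)
      (forall x, R x <-> genfield [:: zeta3; t; t2; t3] x),
      (* (2) Galois, unramified outside p1, p2 *)
      galois_over kk R /\
      (forall (Q : algC -> Prop) (p : algC),
         is_nz_prime_ideal (ints R) Q ->
         ideal_eq (fun x => Q x /\ Ok x) (pideal Ok p) ->
         ~ Q pi1 -> ~ Q pi2 -> ram_index (ints R) Q p 1),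
      (* ramification index of p1 and p2 is 3 *)
      (forall Q : algC -> Prop, is_nz_prime_ideal (ints R) Q -> Q pi1 ->
         ram_index (ints R) Q pi1 3),
      (forall Q : algC -> Prop, is_nz_prime_ideal (ints R) Q -> Q pi2 ->
         ram_index (ints R) Q pi2 3)
    & (* (3) *)
      gal_iso_N3 kk R].
Proof.
have [Op1 pr1 _ _ /(congr_in_subr1_zeta3 Ok_subring)[g1 Og1 Dg1]] := Hpi1.
have [Op2 pr2 _ _ /(congr_in_subr1_zeta3 Ok_subring)[g2 Og2 Dg2]] := Hpi2.
have nz1 := normalized_prime_neq0 Hpi1; have nz2 := normalized_prime_neq0 Hpi2.
have nd12 := Ok_prime_ndvd Op1 pr1 Op2 pr2 nz2 Hdist.
have nd21 : ~ pideal Ok pi2 pi1.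
  by apply: (Ok_prime_ndvd Op2 pr2 Op1 pr1 nz1) => E; apply: Hdist => x; split=> /E.
case: Hadm => Oth [c [alpha [beta [Dth [Oal kb] Nal Pal [eta [Oeta cg]]]]]].
case: Pal => a [b [B [HB cop _ d3b Eal]]].
have HK := genfield_subfield [:: zeta3; a1]; have HO := ints_subring HK.
have [HPi _ _] := HP.
have nz_al := ideal_exp_product_neq0 HK HB Oal HPp2 nz2 cop Eal.
have [Kal Aal] := Oal.
have [g3 [_ Ag3] Dg3] : exists2 g, ints (genfield [:: zeta3; a1]) g &
    theta = eta ^+ 3 + (1 - zeta3) ^+ 3 * g.
  (* The congruence expresses eta^3 through theta; solving for theta changes the sign of [g]. *)
  have [g Og ->] := congr_in_subr1_zeta3 HO cg.
  by exists (- g); [apply: (subringN HO) | rewrite mulrN addrK].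
pose u := a2 * beta / alpha; have Du : u = a2 * beta / alpha by [].
have [x [y [z G]]] := heis_gen_exists Op1 Op2 nz1 nz2 pr2 nd21 Ha1 Ha2 Htau_k Htau_a1
  Dth Kal kb nz_al Nal Ht Du.
split.
- exact: (R_conjugates Op1 Op2 nz1 nz2 pr2 nd21 Ha1 Ha2 Htau_k Htau_a1 Dth Kal kb nz_al Nal
    Ht Du Ht2 Ht3).
- split; first exact: (R_galois Op1 Op2 nz1 nz2 pr2 nd21 Ha1 Ha2 Htau_k Htau_a1 Dth Kal kb
    nz_al Nal Ht Du).
  move=> Q p [HQ [w [Qw nz_w]]] Ep nQ1 nQ2.
  exact: (unramified_outside Op1 Op2 nz1 nz2 pr2 nd21 Ha1 Ha2 Htau_k Htau_a1 Dth Kal kb nz_al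
    Ht Du pr1 nd12 Og1 Og2 Dg1 Dg2 Aal Oeta Ag3 Dg3 HPi HB HPp2 cop d3b Eal HQ G
    (ex_intro2 _ _ w Qw nz_w) Ep nQ1 nQ2).
- move=> Q [HQ _] Q1.
  exact: (ram_index_pi1 Op1 Op2 nz1 nz2 pr2 nd21 Ha1 Ha2 Htau_k Htau_a1 Dth Kal kb nz_al
    Ht Du pr1 nd12 Og1 Og2 Dg1 Dg2 Aal Oeta Ag3 Dg3 HPi HB HPp2 cop d3b Eal HQ G Q1).
- move=> Q [HQ _] Q2.
  exact: (ram_index_pi2 Op1 Op2 nz1 nz2 pr2 nd21 Ha1 Ha2 Htau_k Htau_a1 Dth Kal kb nz_al
    Ht Du pr1 nd12 Og1 Og2 Dg1 Dg2 Aal Oeta Ag3 Dg3 HPi HB HPp2 cop d3b Eal HQ G Q2).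
exact: (R_gal_iso_N3 Op1 Op2 nz1 nz2 pr2 nd21 Ha1 Ha2 Htau_k Htau_a1 Dth Kal kb nz_al Nal Ht Du).
Qed.
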